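(* Let $C:f=0$ be a plus-one generated curve of degree $d\geq 3$ in $\mathbb{P}^2$ with exponents $(d_1,d_2,d_3)$, which is not nearly free, i.e. $d_2<d_3$. Set $k_j=2d-d_j-3$ for $j=1,2,3$ and $T=3d-6$. Then $N(f)$ has the following minimal free resolution as a graded $S$-module: $$0\to S(-d-d_3)\to S(-d-d_3+1)\oplus S(-k_1-2)\oplus S(-k_2-2)\to S(-k_1-1)\oplus S(-k_2-1)\oplus S(-k_3-1)\to S(-k_3).$$ In particular, $\sigma(C)=k_3$ and the Hilbert function of $N(f)$ is given by the following formulas. (1) $n(f)_k=0$ for $k<k_3$, and $k_3<T/2$. (2) $n(f)_k=k-k_3+1$ for $k_3\leq k\leq k_2$, and $k_2=d+d_1-3\leq T/2$. (3) $n(f)_k=d_3-d_2+1=\nu(C)$ for $k_2\leq k\leq T/2$.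
   Context: Let $S=\mathbb{C}[x,y,z]$ with its standard grading, and let $C:f=0$ be a reduced curve of degree $d$ in $\mathbb{P}^2$, with $f\in S$ homogeneous of degree $d$. Let $J_f=(f_x,f_y,f_z)$. Put $AR(f)=\{(a,b,c)\in S^3: af_x+bf_y+cf_z=0\}$, a graded $S$-module in which $(a,b,c)$ has degree $k$ when $a,b,c\in S_k$. The curve $C$ is an $m$-syzygy curve if a minimal set of homogeneous generators of $AR(f)$ has $m$ elements; the degrees $d_1\leq\dots\leq d_m$ of these generators are the exponents of $C$. A plus-one generated curve is a 3-syzygy curve with $d_1+d_2=d$; it is nearly free if moreover $d_2=d_3$. Let $I_f$ be the saturation of $J_f$ with respect to $\mathbf{m}=(x,y,z)$ and $N(f)=I_f/J_f$ (the Jacobian module). Set $n(f)_k=\dim N(f)_k$, $\nu(C)=\max_j n(f)_j$ and $\sigma(C)=\min\{j:n(f)_j\neq 0\}$. *)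

(* Defs.v *)
From HB Require Import structures.
From mathcomp Require Import all_boot all_order all_algebra.
From mathcomp Require Import boolp classical_sets.
From mathcomp Require Import mpoly.

Set Implicit Arguments.
Unset Strict Implicit.
Unset Printing Implicit Defensive.

Import Order.TTheory GRing.Theory Num.Theory.
Import Quotient.
Local Open Scope ring_scope.
Local Open Scope quotient_scope.

Section Submodule.
Variables (R : comNzRingType) (V : lmodType R) (I : submodClosed V).

Record submod := Submod { submod_val :> V; _ : submod_val \in I }.

HB.instance Definition _ := [isSub for @submod_val].
HB.instance Definition _ := [Choice of submod by <:].
HB.instance Definition _ := [SubChoice_isSubLmodule of submod by <:].

(* The submodule J of V, seen inside the submodule I. *)
Definition in_submod (J : {pred V}) : {pred submod} := fun x => submod_val x \in J.

Lemma in_submod_closed (J : submodClosed V) : submod_closed (in_submod J).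
Proof.
have inE x : (x \in in_submod J) = (submod_val x \in J) by [].
split=> [|a u v]; rewrite !inE ?rpred0 //.
by move=> uJ vJ; rewrite rpredD ?rpredZ.
Qed.

HB.instance Definition _ (J : submodClosed V) :=
  GRing.isSubmodClosed.Build R submod (in_submod J) (in_submod_closed J).

End Submodule.

Section QuotientModule.
Variables (R : comNzRingType) (V : lmodType R) (I : submodClosed V).

(* The structure submodClosed, shared with semimodules, does not carry closure
   under opposites, which the additive quotient {quot _} needs. *)
Definition submod_pred : {pred V} := fun v => v \in I.

Lemma submod_pred_closed : zmod_closed submod_pred.
Proof.
split=> [|u v uI vI]; rewrite unfold_in ?rpred0 //.
by rewrite -scaleN1r rpredD ?rpredZ.
Qed.

HB.instance Definition _ := GRing.isZmodClosed.Build V submod_pred submod_pred_closed.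

Definition lmod_quot := {quot submod_pred}.

HB.instance Definition _ := GRing.Zmodule.on lmod_quot.
HB.instance Definition _ := EqQuotient.on lmod_quot.

Definition lquot_proj (v : V) : lmod_quot := \pi_{quot submod_pred} v.

Lemma lquot_projP (u v : V) : (lquot_proj u = lquot_proj v) <-> (u - v \in I).
Proof. by split=> [/eqP|h]; [|apply/eqP]; rewrite /lquot_proj -idealrBE. Qed.

Definition lquot_scale (a : R) (q : lmod_quot) : lmod_quot :=
  lquot_proj (a *: repr q).

Lemma lquot_reprK (q : lmod_quot) : lquot_proj (repr q) = q.
Proof. exact: reprK. Qed.

Lemma lquot_projD u v : lquot_proj (u + v) = lquot_proj u + lquot_proj v.
Proof. by rewrite /lquot_proj raddfD. Qed.

Lemma lquot_scaleE a v : lquot_scale a (lquot_proj v) = lquot_proj (a *: v).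
Proof. by apply/lquot_projP; rewrite -scalerBr rpredZ //; apply/lquot_projP/lquot_reprK. Qed.

Lemma lquot_scaleA a b q : lquot_scale a (lquot_scale b q) = lquot_scale (a * b) q.
Proof. by rewrite -[q]lquot_reprK !lquot_scaleE scalerA. Qed.

Lemma lquot_scale1 : left_id 1 lquot_scale.
Proof. by move=> q; rewrite -[q]lquot_reprK !lquot_scaleE scale1r. Qed.

Lemma lquot_scaleDr : right_distributive lquot_scale +%R.
Proof.
move=> a u v; rewrite -[u]lquot_reprK -[v]lquot_reprK -lquot_projD.
by rewrite !lquot_scaleE scalerDr lquot_projD.
Qed.

Lemma lquot_scaleDl q : {morph lquot_scale^~ q : a b / a + b}.
Proof.
by move=> a b; rewrite -[q]lquot_reprK !lquot_scaleE scalerDl lquot_projD.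
Qed.

HB.instance Definition _ := GRing.Zmodule_isLmodule.Build R lmod_quot
  lquot_scaleA lquot_scale1 lquot_scaleDr lquot_scaleDl.

Lemma lquot_proj_is_linear : linear lquot_proj.
Proof. by move=> a u v; rewrite lquot_projD -lquot_scaleE. Qed.

HB.instance Definition _ :=
  GRing.isLinear.Build R V lmod_quot _ lquot_proj lquot_proj_is_linear.

End QuotientModule.

Section Ideals.
Variable K : fieldType.
Local Notation S := {mpoly K[3]}.

Definition ideal_gen m (g : 'I_m -> S) : {pred S^o} :=
  fun p => `[< exists a : 'I_m -> S, p = \sum_i a i * g i >].

Lemma ideal_gen_closed m (g : 'I_m -> S) : submod_closed (ideal_gen g).
Proof.
split=> [|c p q /asboolP[a pE] /asboolP[b qE]]; apply/asboolP.
  by exists (fun=> 0); rewrite big1 // => i _; rewrite mul0r.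
exists (fun i => c * a i + b i); rewrite pE qE /= [c *: _]mulr_sumr -big_split.
by apply: eq_bigr => i _; rewrite mulrDl mulrA.
Qed.

HB.instance Definition _ m (g : 'I_m -> S) :=
  GRing.isSubmodClosed.Build S S^o (ideal_gen g) (ideal_gen_closed g).

Definition irrelevant_ideal : {pred S^o} := ideal_gen (fun i : 'I_3 => 'X_i).

HB.instance Definition _ := GRing.SubmodClosed.on irrelevant_ideal.

(* m^N * p is contained in I for some N: m^N is generated by the products of N
   elements of m. *)
Definition saturation (I : {pred S^o}) : {pred S^o} :=
  fun p => `[< exists N : nat, forall q : 'I_N -> S,
    (forall i, q i \in irrelevant_ideal) -> (\prod_i q i) * p \in I >].

Lemma saturation_closed (I : submodClosed S^o) : submod_closed (saturation I).
Proof.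
split=> [|c p q /asboolP[N1 h1] /asboolP[N2 h2]]; apply/asboolP.
  by exists 0%N => q _; rewrite mulr0; exact: (@rpred0 _ I).
exists (N1 + N2)%N => g gP; rewrite big_split_ord /=.
set g1 := \prod_(i < N1) _; set g2 := \prod_(i < N2) _.
have h1' : g1 * p \in I by apply: h1.
have h2' : g2 * q \in I by apply: h2.
have -> : g1 * g2 * (c *: p + q) = (g2 * c) *: (g1 * p : S^o) + g1 *: (g2 * q : S^o).
  rewrite mulrDr; congr (_ + _); last by rewrite /GRing.scale /= mulrA.
  by rewrite /GRing.scale /= -!mulrA mulrCA; congr (_ * _); rewrite mulrCA.
by apply: (@rpredD _ I); apply: (@rpredZ _ _ I).
Qed.

HB.instance Definition _ (I : submodClosed S^o) :=
  GRing.isSubmodClosed.Build S S^o (saturation I) (saturation_closed I).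

End Ideals.

Section GradedModules.
Variable K : fieldType.
Local Notation S := {mpoly K[3]}.
Local Open Scope classical_set_scope.

(* The predicate p \in S_k, with S_k = 0 for k < 0. *)
Definition homog_at (k : int) (p : S) : bool :=
  match k with Posz n => p \is n.-homog | Negz _ => p == 0 end.

(* The degree k component of the free module \bigoplus_j S(-a_j). *)
Definition free_comp (a : seq int) (k : int) : set 'rV[S]_(size a) :=
  [set v | forall j : 'I_(size a), homog_at (k - a`_j) (v 0 j)].

(* A graded module is given by a module M and its components Mk; a i lists the
   twists of the i-th free module F_i = \bigoplus_j S(-(a i)_j), and an empty
   list gives F_i = 0. *)
Definition minimal_free_resolution (M : lmodType S) (Mk : int -> set M)
    (a : nat -> seq int) : Prop :=
  exists (eps : {linear 'rV[S]_(size (a 0%N)) -> M})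
         (d : forall i, {linear 'rV[S]_(size (a i.+1)) -> 'rV[S]_(size (a i))}),
    [/\ (forall k v, free_comp k v -> Mk k (eps v)) /\
        (forall i k v, free_comp k v -> free_comp k (d i v)),
        (forall x, exists v, eps v = x),
        (forall v, eps v = 0 <-> exists w, d 0%N w = v),
        (forall i v, d i v = 0 <-> exists w, d i.+1 w = v) &
        (forall i v j, d i v 0 j \in @irrelevant_ideal K)].

(* A is the K-span of r elements of M that are linearly independent over K. *)
Definition has_dim (M : lmodType S) (A : set M) (r : nat) : Prop :=
  exists b : 'I_r -> M, (forall i, A (b i)) /\
    forall x, A x <-> exists! c : 'rV[K]_r, x = \sum_i (c 0 i)%:MP *: b i.

End GradedModules.

Section PlaneCurves.
Variable K : fieldType.
Local Notation S := {mpoly K[3]}.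
Local Open Scope classical_set_scope.
Implicit Types f : S.

Definition reduced_curve (d : nat) f : Prop :=
  [/\ f \is d.-homog, f != 0 &
      forall g h, f = g ^+ 2 * h -> g \is a GRing.unit].

Definition AR f : set 'rV[S]_3 :=
  [set v | \sum_(i < 3) v 0 i * f^`M(i) = 0].

(* ds lists the degrees of a set of homogeneous generators of AR(f) which is
   minimal for inclusion. *)
Definition is_exponents f (ds : seq nat) : Prop :=
  sorted leq ds /\
  exists r : 'I_(size ds) -> 'rV[S]_3,
    [/\ forall i, AR f (r i) /\ forall j, r i 0 j \is (nth 0%N ds i).-homog,
        forall v, AR f v -> exists a : 'I_(size ds) -> S, v = \sum_i a i *: r i &
        forall B : {set 'I_(size ds)},
          (forall v, AR f v ->
             exists a : 'I_(size ds) -> S, v = \sum_(i in B) a i *: r i) ->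
          B = finset.setT].

Definition plus_one_generated (d : nat) f (d1 d2 d3 : nat) : Prop :=
  is_exponents f [:: d1; d2; d3] /\ (d1 + d2 = d)%N.

Definition jacobian_ideal f : {pred S^o} := ideal_gen (fun i : 'I_3 => f^`M(i)).
HB.instance Definition _ f := GRing.SubmodClosed.on (jacobian_ideal f).

Definition sat_jacobian_ideal f : {pred S^o} := saturation (jacobian_ideal f).
HB.instance Definition _ f := GRing.SubmodClosed.on (sat_jacobian_ideal f).

Definition sat_jacobian_module f := submod (sat_jacobian_ideal f).

Definition jacobian_in_sat f : {pred sat_jacobian_module f} :=
  in_submod (jacobian_ideal f).
HB.instance Definition _ f := GRing.SubmodClosed.on (@jacobian_in_sat f).

Definition jacobian_module f : lmodType S := lmod_quot (@jacobian_in_sat f).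

Definition jacobian_comp f (k : int) : set (jacobian_module f) :=
  [set lquot_proj (@jacobian_in_sat f) x |
    x in [set x : sat_jacobian_module f | homog_at k (submod_val x)]].

End PlaneCurves.

Arguments jacobian_in_sat {K} f _.
Arguments jacobian_comp {K} f k _.

Section FiniteDimension.
Variable K : fieldType.
Local Notation S := {mpoly K[3]}.
Local Open Scope classical_set_scope.

Lemma subspace_mx m (W : 'rV[K]_m -> Prop) :
  W 0 -> (forall a u v, W u -> W v -> W (a *: u + v)) ->
  exists B : 'M[K]_m, forall c, W c <-> (c <= B)%MS.
Proof.
move=> W0 Wlin.
have WD u v : W u -> W v -> W (u + v).
  by move=> uW vW; rewrite -[u]scale1r; apply: Wlin.
have WZ a u : W u -> W (a *: u) by move=> uW; rewrite -[a *: u]addr0; apply: Wlin.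
pose P r := `[< exists B : 'M[K]_m, (forall c, (c <= B)%MS -> W c) /\ \rank B = r >].
have exP : exists r, P r.
  exists 0%N; apply/asboolP; exists 0; split; last exact: mxrank0.
  by move=> c; rewrite submx0 => /eqP->.
have ubP r : P r -> (r <= m)%N by move=> /asboolP[B [_ <-]]; exact: rank_leq_row.
case: (ex_maxnP exP ubP) => r /asboolP[B [BW <-]] maxB.
exists B => c; split=> [cW|]; last exact: BW.
apply/negPn/negP => ncB.
suff /maxB : P (\rank (B + c)%MS).
  rewrite leqNgt => /negP; apply; apply: rank_ltmx.
  by rewrite ltmxE addsmxSl addsmx_sub submx_refl.
apply/asboolP; exists (B + c)%MS; split=> // u /sub_addsmxP[[w1 w2] /= ->].
apply: WD; first by apply: BW; exact: submxMl.
by rewrite [w2]mx11_scalar mul_scalar_mx; apply: WZ.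
Qed.

Lemma has_dim_image (M : lmodType S) m (W : 'rV[K]_m -> Prop) (L : 'rV[K]_m -> M) :
  W 0 -> (forall a u v, W u -> W v -> W (a *: u + v)) ->
  (forall a u v, W u -> W v -> L (a *: u + v) = a%:MP *: L u + L v) ->
  exists r, has_dim [set x | exists2 c, W c & L c = x] r.
Proof.
move=> W0 Wlin Llin.
have L0 : L 0 = 0.
  by have := Llin (-1) 0 0 W0 W0; rewrite scaler0 addr0 mpolyCN mpolyC1 scaleN1r addNr.
have [BW WP] := subspace_mx W0 Wlin.
have [BZ ZP] : exists B : 'M[K]_m, forall c, (W c /\ L c = 0) <-> (c <= B)%MS.
  apply: subspace_mx => // a u v [uW u0] [vW v0]; split; first exact: Wlin.
  by rewrite Llin // u0 v0 scaler0 addr0.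
pose D := (BW :\: BZ)%MS; pose b := row_base D.
have bW n (c : 'M_(n, _)) : (c *m b <= BW)%MS.
  by rewrite (submx_trans (submxMl _ _)) // eq_row_base diffmxSl.
have LE (c : 'rV_(\rank D)) : L (c *m b) = \sum_i (c 0 i)%:MP *: L (row i b).
  rewrite mulmx_sum_row.
  have: W (\sum_i c 0 i *: row i b) /\
        L (\sum_i c 0 i *: row i b) = \sum_i (c 0 i)%:MP *: L (row i b).
    elim/big_rec2: _ => [|i x y _ [yW yE]]; first by [].
    have rW : W (row i b).
      by apply/WP; rewrite (submx_trans (row_sub _ _)) // -[b]mul1mx bW.
    by split; [exact: Wlin|rewrite Llin // yE].
  by case.
exists (\rank D), (fun i => L (row i b)); split.
  move=> i; exists (row i b) => //; apply/WP.
  by rewrite (submx_trans (row_sub _ _)) // -[b]mul1mx bW.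
move=> x; split; last first.
  by move=> [c [-> _]]; exists (c *m b); [exact/WP/bW|exact: LE].
move=> [w /WP wW <-].
have: (w <= D + (BW :&: BZ))%MS by rewrite addsmx_diff_cap_eq.
move=> /sub_addsmxP[[u1 u2] /= wE].
have /submxP[c cE] : (u1 *m D <= b)%MS by rewrite eq_row_base submxMl.
have u2Z : (u2 *m (BW :&: BZ) <= BZ)%MS.
  exact: submx_trans (submxMl _ _) (capmxSr _ _).
have /ZP[u2W Lu2] := u2Z.
have Lw : L w = L (c *m b).
  rewrite wE cE -[c *m b]scale1r Llin //; last exact/WP/bW.
  by rewrite Lu2 addr0 mpolyC1 !scale1r.
exists c; split; first by rewrite Lw LE.
move=> c' c'E; apply: (row_free_inj (row_base_free D)).
apply/eqP; rewrite -subr_eq0 -mulmxBl; apply/eqP.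
suff : ((c - c') *m b <= D :&: BZ)%MS by rewrite capmx_diff submx0 => /eqP.
rewrite sub_capmx; apply/andP; split.
  by rewrite (submx_trans (submxMl _ _)) // eq_row_base.
apply/ZP; split; first exact/WP/bW.
rewrite mulmxBl addrC -scaleN1r Llin; try exact/WP/bW.
by rewrite -Lw LE -c'E mpolyCN mpolyC1 scaleN1r addNr.
Qed.

Lemma homog_at_lin k (a : K) (p q : S) :
  homog_at k p -> homog_at k q -> homog_at k (a *: p + q).
Proof.
case: k => k /=; first by move=> pk qk; rewrite rpredD ?rpredZ.
by move=> /eqP-> /eqP->; rewrite scaler0 addr0.
Qed.

Lemma jacobian_comp_dim (f : S) (k : int) : exists r, has_dim (jacobian_comp f k) r.
Proof.
pose n := `|k|%N.+1; pose I : finType := 'X_{1..3 < n}.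
pose e (i : 'I_#|I|) : 'X_{1..3} := (enum_val i : 'X_{1..3 < n}).
pose p (c : 'rV[K]_#|I|) : S := \sum_(i < #|I|) c 0 i *: 'X_[e i].
have plin a u v : p (a *: u + v) = a *: p u + p v.
  rewrite /p scaler_sumr -big_split; apply: eq_bigr => i _ /=.
  by rewrite !mxE scalerDl scalerA.
have p_surj q : homog_at k q -> exists c, p c = q.
  move=> qk; exists (\row_i q@_(e i)).
  have sq : (msize q <= n)%N.
    case: k @n @I @e @p {plin} qk => k n I e p /=; last by move=> /eqP->; rewrite msize0.
    move=> /dhomogP qk; rewrite msizeE big_seq.
    by elim/big_ind: _ => // [x y ? ?|m /qk /= ->] //; rewrite geq_max; exact/andP.
  rewrite /p [RHS](mpolywE sq) (reindex (enum_val : 'I_#|I| -> I)) /=; last first.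
    exact/onW_bij/enum_val_bij.
  by apply: eq_bigr => i _; rewrite mxE.
pose W c := homog_at k (p c) /\ p c \in sat_jacobian_ideal f.
pose L c : jacobian_module f :=
  lquot_proj (jacobian_in_sat f) (insubd (0 : sat_jacobian_module f) (p c)).
have WE c : W c -> submod_val (insubd (0 : sat_jacobian_module f) (p c)) = p c.
  by move=> [_ pI]; exact: (insubdK (0 : sat_jacobian_module f)).
have Wlin a u v : W u -> W v -> W (a *: u + v).
  move=> [uk uI] [vk vI]; rewrite /W plin; split; first exact: homog_at_lin.
  rewrite -mul_mpolyC; apply: (@rpredD _ (sat_jacobian_ideal f)) => //.
  exact: (@rpredZ _ _ (sat_jacobian_ideal f)).
have p0 : p 0 = 0 by rewrite /p big1 // => i _; rewrite mxE scale0r.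
have W0 : W 0.
  rewrite /W p0; split; last exact: (@rpred0 _ (sat_jacobian_ideal f)).
  by case: (k) => m /=; rewrite ?rpred0.
have Llin a u v : W u -> W v -> L (a *: u + v) = a%:MP *: L u + L v.
  move=> uW vW; rewrite /L -linearP /=; congr (lquot_proj _ _); apply: val_inj.
  rewrite /= WE; last exact: Wlin.
  by rewrite plin -mul_mpolyC !WE.
have [r dimr] := has_dim_image W0 Wlin Llin; exists r.
suff -> : jacobian_comp f k = [set x | exists2 c, W c & L c = x] by [].
apply/seteqP; split=> x /=.
  move=> [y yk <-]; have [c cE] := p_surj _ yk.
  have yI : submod_val y \in sat_jacobian_ideal f by case: (y).
  exists c; first by rewrite /W cE.
  by rewrite /L cE; congr (lquot_proj _ _); exact: valKd.
move=> [c cW <-]; exists (insubd (0 : sat_jacobian_module f) (p c)) => //=.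
by rewrite WE //; case: cW.
Qed.

End FiniteDimension.

Section Invariants.
Variable K : fieldType.
Local Notation S := {mpoly K[3]}.
Local Open Scope classical_set_scope.
Implicit Types f : S.

Definition jacobian_hilb f (k : int) : nat := sval (cid (jacobian_comp_dim f k)).

Definition is_sigma f (s : int) : Prop :=
  let A := [set j | jacobian_hilb f j != 0%N] in A s /\ lbound A s.

Definition is_nu f (v : nat) : Prop :=
  let A := range (jacobian_hilb f) in A v /\ ubound A v.

End Invariants.

(* Main.v *)
Require Import Defs.
From HB Require Import structures.
From mathcomp Require Import all_boot all_order all_algebra.
From mathcomp.reals Require Import reals.
From mathcomp Require Import complex.
From mathcomp Require Import boolp classical_sets ring zify.
From mathcomp Require Import mpoly.

Set Implicit Arguments.
Unset Strict Implicit.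
Unset Printing Implicit Defensive.

Import Order.TTheory GRing.Theory Num.Theory.
Local Open Scope ring_scope.

(** The three generators r1, r2, r3 of AR(f) satisfy ri x rj = ck grad f for a triple
    c = (c1, c2, c3) of forms of degrees d3+1-d1, d3+1-d2 and 1, because the partial derivatives of
    a reduced f have no common factor.  Hence c1 r1 + c2 r2 + c3 r3 = 0, every relation between the
    ri is a multiple of c, and c is a regular sequence: if c1, c2 had a common factor h modulo c3,
    the relation would split along (c3, h), and the syzygies of c3 and h would force 1 into the
    ideal (c3, h).

    Exactness of the Koszul complex of c yields vectors A1, A2, A3 with r = c x A, and then a form
    p0 of degree k3 with Ai . grad f = ci p0.  The annihilator of p0 modulo J_f is (c1, c2, c3), and
    J_f + S p0 is a determinantal ideal with a Hilbert-Burch resolution, hence saturated.  So N(f)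
    is S/(c1, c2, c3) shifted by k3: its resolution is the Koszul complex, and its Hilbert function
    is that of two coprime binary forms of degrees d3+1-d1 and d3+1-d2. *)

(** * Greatest common divisors in polynomial rings *)

(** The form c3 is linear because its degree is d1 + d2 - (d - 1) and d1 + d2 = d. It can therefore
    be solved for one variable, and S/(c3), a polynomial ring in two variables, is realized inside S
    as the image of an idempotent substitution. Modulo c3 the regularity of c becomes coprimality of
    two binary forms, and every dimension count concerns binary forms only. Coprimality is needed
    both in S, for the partial derivatives, and modulo c3; both cases rest on the existence of gcds
    in S, obtained by induction on the number of variables without factorization into irreducibles.
    The ci have no constant term because the generators are minimal; this drives the induction over
    the saturation as well as the minimality of the resolution. That p0 itself lies in the
    saturation is a separate point: every form of degree (d3 - d1) + (d3 - d2) + 1 is in (c1, c2,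
    c3), because the Sylvester map of the two binary forms is bijective. *)

Definition rdvd (R : nzRingType) (a b : R) : Prop := exists c, b = c * a.

(** Only the universal property is required, with no normalization and no irreducible elements, so
    it passes along ring isomorphisms. *)
Definition gcd_domain (R : nzRingType) : Prop :=
  forall a b : R, exists g, forall h, rdvd h g <-> rdvd h a /\ rdvd h b.

Section Divisibility.
Variable R : idomainType.
Implicit Types a b c g h v : R.

Lemma rdvd0 a : rdvd a 0.
Proof. by exists 0; rewrite mul0r. Qed.

Lemma rdvd_refl a : rdvd a a.
Proof. by exists 1; rewrite mul1r. Qed.

Lemma rdvd_trans a b c : rdvd a b -> rdvd b c -> rdvd a c.
Proof. by move=> [u ->] [v ->]; exists (v * u); rewrite mulrA. Qed.

Lemma rdvd_mull a b c : rdvd a b -> rdvd a (c * b).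
Proof. by move=> [u ->]; exists (c * u); rewrite mulrA. Qed.

Lemma rdvd_mulr a b c : rdvd a b -> rdvd a (b * c).
Proof. by rewrite mulrC; apply: rdvd_mull. Qed.

Lemma rdvdD a b c : rdvd a b -> rdvd a c -> rdvd a (b + c).
Proof. by move=> [u ->] [v ->]; exists (u + v); rewrite mulrDl. Qed.

Lemma rdvdB a b c : rdvd a b -> rdvd a c -> rdvd a (b - c).
Proof. by move=> [u ->] [v ->]; exists (u - v); rewrite mulrBl. Qed.

Lemma rdvd_mul2r a b v : v != 0 -> rdvd (a * v) (b * v) -> rdvd a b.
Proof.
by move=> v0 [c cE]; exists c; apply: (mulIf v0); rewrite cE mulrA.
Qed.

Lemma rdvd_unit a b : rdvd a b -> b \is a GRing.unit -> a \is a GRing.unit.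
Proof. by move=> [c ->]; rewrite unitrM => /andP[]. Qed.

Hypothesis gcdR : gcd_domain R.

Lemma gcd_seq (s : seq R) :
  exists g, forall h, rdvd h g <-> {in s, forall x, rdvd h x}.
Proof.
elim: s => [|x s [g gP]]; first by exists 0 => h; split=> // _; exact: rdvd0.
have [g' g'P] := gcdR x g; exists g' => h; split.
  by move=> /g'P[hx /gP hs] y; rewrite inE => /predU1P[->|/hs].
move=> hs; apply/g'P; split; first by apply: hs; rewrite mem_head.
by apply/gP => y ys; apply: hs; rewrite inE ys orbT.
Qed.

(* The gcd of the x * v is v times the gcd of the x. *)
Lemma coprime_cancel (s : seq R) a v :
  (forall h, {in s, forall x, rdvd h x} -> h \is a GRing.unit) ->
  {in s, forall x, rdvd a (x * v)} -> rdvd a v.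
Proof.
move=> cop av; have [->|v0] := eqVneq v 0; first exact: rdvd0.
have [g gP] := gcd_seq [seq x * v | x <- s].
have [|t tE] := (gP v).2; first by move=> _ /mapP[x _ ->]; exact: rdvd_mull (rdvd_refl v).
have ut : t \is a GRing.unit.
  apply: cop => x xs; apply: (rdvd_mul2r v0); rewrite -tE.
  by apply: (gP g).1; [exact: rdvd_refl|exact: map_f].
have : rdvd a g by apply/gP => _ /mapP[x xs ->]; exact: av.
by rewrite tE => -[c cE]; exists (t^-1 * c); rewrite -mulrA -cE mulKr.
Qed.

Lemma coprime_cancel2 a b v :
  (forall h, rdvd h a -> rdvd h b -> h \is a GRing.unit) ->
  rdvd a (b * v) -> rdvd a v.
Proof.
move=> cop abv; apply: (@coprime_cancel [:: a; b]) => [h hs|x].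
  by apply: cop; apply: hs; rewrite !inE eqxx ?orbT.
rewrite !inE => /orP[]/eqP-> //; exact: rdvd_mulr (rdvd_refl a).
Qed.

(** A common divisor [h] of the cofactors makes [h * g] a common divisor of [a] and [b], hence a
    divisor of [g]; cancelling [g] needs one of [a], [b] to be nonzero. *)
Lemma gcd_factor a b : (a != 0) || (b != 0) ->
  exists g u v, [/\ g != 0, a = u * g, b = v * g &
    forall h, rdvd h u -> rdvd h v -> h \is a GRing.unit].
Proof.
move=> ab0; have [g gP] := gcdR a b.
have [[u uE] [v vE]] := (gP g).1 (rdvd_refl g).
have g0 : g != 0.
  by apply: contraTneq ab0 => g0; rewrite uE vE g0 !mulr0 eqxx.
exists g, u, v; split=> // h [u' u'E] [v' v'E].
have /gP : rdvd (h * g) a /\ rdvd (h * g) b.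
  by split; [exists u'|exists v']; rewrite mulrA -?u'E -?v'E.
move=> [c cE]; apply: (@rdvd_unit h 1); last exact: unitr1.
by exists c; apply: (mulIf g0); rewrite mul1r -mulrA -cE.
Qed.

End Divisibility.

(** * Gauss's lemma and gcds of polynomials in one variable *)

Section GaussLemma.
Import Pdiv.CommonIdomain Pdiv.WeakIdomain.
Variable R : idomainType.
Hypothesis gcdR : gcd_domain R.
Implicit Types (p q : {poly R}) (c k : R).

Definition primitive p := forall c, (forall i, rdvd c p`_i) -> c \is a GRing.unit.

Lemma coef_rdvd c p : (forall i, rdvd c p`_i) -> exists q, p = c *: q.
Proof.
move: {2}(size p) (leqnn (size p)) => n; elim: n p => [|n IHn] p.
  by rewrite leqn0 size_poly_eq0 => /eqP-> _; exists 0; rewrite scaler0.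
elim/poly_ind: p => [|p a _] sp cp; first by exists 0; rewrite scaler0.
have [q qE] : exists q, p = c *: q.
  apply: IHn => [|i].
    have [->|p0] := eqVneq p 0; first by rewrite size_poly0.
    by move: sp; rewrite size_MXaddC (negPf p0).
  by have := cp i.+1; rewrite coefD coefMX coefC addr0.
have [b bE] := cp 0%N; rewrite coefD coefMX coefC add0r /= in bE.
by exists (q * 'X + b%:P); rewrite qE bE scalerDr scalerAl -!mul_polyC polyCM [_ * c%:P]mulrC.
Qed.

Lemma primitive_cancel c k p :
  primitive p -> (forall i, rdvd c (k * p`_i)) -> rdvd c k.
Proof.
move=> prim cp; apply: (@coprime_cancel _ gcdR (p : seq R)) => [h hp|x].
  apply: prim => i; have [ip|ip] := ltnP i (size p); first exact/hp/mem_nth.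
  by rewrite nth_default //; exact: rdvd0.
by move=> /(nthP 0)[i _ <-]; rewrite mulrC.
Qed.

Lemma content p : p != 0 -> exists c q, [/\ c != 0, p = c *: q & primitive q].
Proof.
move=> p0; have [c cP] := gcd_seq gcdR (p : seq R).
have cp i : rdvd c p`_i.
  have [ip|ip] := ltnP i (size p); last by rewrite nth_default //; exact: rdvd0.
  by apply: (cP c).1 (rdvd_refl c) _ _; exact: mem_nth.
have [q qE] := coef_rdvd cp; exists c, q.
have c0 : c != 0 by apply: contraNneq p0 => c0; rewrite qE c0 scale0r.
split=> // e eq; have [t tE] : rdvd (e * c) c.
  apply/cP => x /(nthP 0)[i _ <-]; rewrite qE coefZ.
  by have [t ->] := eq i; exists t; rewrite mulrCA [c * e]mulrC.
apply: (@rdvd_unit _ e 1); last exact: unitr1.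
by exists t; apply: (mulIf c0); rewrite mul1r -mulrA.
Qed.

Lemma size_sub_lead p : p != 0 -> (size (p - lead_coef p *: 'X^((size p).-1))%R < size p)%N.
Proof.
move=> p0; rewrite -[X in (_ < X)%N](@prednK (size p)) ?size_poly_gt0 // ltnS.
apply/leq_sizeP => j; rewrite leq_eqVlt coefB coefZ coefXn => /predU1P[<-|lj].
  by rewrite eqxx mulr1 subrr.
rewrite gtn_eqF // mulr0 subr0 nth_default //.
by rewrite -[X in (X <= _)%N](@prednK (size p)) ?size_poly_gt0.
Qed.

Lemma primitive_neq0 p : primitive p -> p != 0.
Proof.
move=> prim; apply: contraTneq isT => p0.
have : (0 : R) \is a GRing.unit by apply: prim => i; rewrite p0 coef0; exact: rdvd0.
by rewrite unitr0.
Qed.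

(* Gauss's lemma without irreducible elements: a common divisor of the coefficients of p q is
   coprime to both leading coefficients, hence a unit since it divides their product. *)
Lemma primitiveM p q : primitive p -> primitive q -> primitive (p * q).
Proof.
move: {2}(size p + size q)%N (leqnn (size p + size q)) => n.
elim: n p q => [|n IHn] p q spq pp pq.
  have := primitive_neq0 pp; rewrite -size_poly_gt0.
  by move: spq; rewrite leqn0 addn_eq0 => /andP[/eqP->].
(* Without its leading term [p1] is [c' *: p0] with [p0] primitive, and [p0 * q1] is primitive by
   induction. So a divisor of the leading coefficient that divides [p1 * q1] also divides [c'],
   hence all of [p1]. *)
have half p1 q1 : (size p1 + size q1 <= n.+1)%N -> primitive p1 -> primitive q1 ->
    forall c, (forall i, rdvd c (p1 * q1)`_i) -> rdvd c (lead_coef p1) ->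
    c \is a GRing.unit.
  move=> s1 prim1 prim2 g gpq ga; apply: (prim1); set a := lead_coef p1.
  pose p' := p1 - a *: 'X^((size p1).-1).
  have p1E : p1 = p' + a *: 'X^((size p1).-1) by rewrite subrK.
  have p1n0 := primitive_neq0 prim1.
  have gX i : rdvd g (a *: 'X^((size p1).-1))`_i by rewrite coefZ; exact: rdvd_mulr.
  have gp'q i : rdvd g (p' * q1)`_i.
    rewrite mulrBl coefB; apply: rdvdB; first exact: gpq.
    by rewrite -scalerAl coefZ; exact: rdvd_mulr.
  move=> i; rewrite {1}p1E coefD; apply: rdvdD; last exact: gX.
  have [->|p'0] := eqVneq p' 0; first by rewrite coef0; exact: rdvd0.
  have [c' [p0 [c'0 p'E prim0]]] := content p'0.
  rewrite p'E coefZ; apply: rdvd_mulr.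
  apply: (@primitive_cancel _ _ (p0 * q1)) => [|j].
    apply: IHn => //; rewrite -ltnS; apply: leq_trans s1; rewrite ltn_add2r.
    by rewrite -(size_scale p0 c'0) -p'E size_sub_lead.
  by rewrite -coefZ scalerAl -p'E.
move=> c cpq.
have u1 := half _ _ spq pp pq.
rewrite addnC in spq; have u2 := half _ _ spq pq pp.
have cb : rdvd c (lead_coef q).
  apply: (coprime_cancel2 gcdR (b := lead_coef p)) => [h hc ha|].
    by apply: u1 => // i; exact: rdvd_trans hc (cpq i).
  by rewrite -lead_coefM; exact: cpq.
by apply: u2 => // i; rewrite mulrC; exact: cpq.
Qed.

(** Removes the constants left by pseudo-division: in [k *: p = s * q], [k] divides the content of
    [s] times a primitive polynomial, hence that content. *)
Lemma primitive_rdvdZ k p q : k != 0 -> primitive q -> rdvd q (k *: p) -> rdvd q p.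
Proof.
move=> k0 prim [s sE].
have [s' s'E] : exists s', s = k *: s'.
  have [->|s0] := eqVneq s 0; first by exists 0; rewrite scaler0.
  have [c [s0' [c0 s0E prims]]] := content s0.
  apply: coef_rdvd => i; rewrite s0E coefZ; apply: rdvd_mulr.
  apply: (primitive_cancel (primitiveM prims prim)) => j.
  by rewrite -coefZ scalerAl -s0E -sE coefZ; exact: rdvd_mulr (rdvd_refl k).
have kP0 : k%:P != 0 by rewrite polyC_eq0.
by exists s'; apply: (mulfI kP0); rewrite !mul_polyC sE s'E scalerAl.
Qed.

(** The gcd is the gcd of the contents times the primitive part of [gcdp p q], which is a gcd up to
    constants, as over the fraction field; [primitive_rdvdZ] then removes the constants. *)
Lemma gcd_poly : gcd_domain {poly R}.
Proof.
move=> p q; have [->|p0] := eqVneq p 0.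
  by exists q => h; split=> [?|[]//]; split=> //; exact: rdvd0.
have [->|q0] := eqVneq q 0.
  by exists p => h; split=> [?|[]//]; split=> //; exact: rdvd0.
have [cp [p1 [cp0 pE prim_p]]] := content p0.
have [cq [q1 [cq0 qE prim_q]]] := content q0.
have [c cP] := gcdR cp cq.
have G0 : gcdp p q != 0 by rewrite gcdp_eq0 negb_and p0.
have [cg [g [cg0 gE prim_g]]] := content G0.
have part r cr r1 : r = cr *: r1 -> gcdp p q %| r -> rdvd g r1 \/ cr = 0.
  move=> rE /dvdpP[[k s] /= k0 sE]; have [->|cr0] := eqVneq cr 0; [by right|left].
  apply: (@primitive_rdvdZ (k * cr)) => //; first by rewrite mulf_neq0.
  by rewrite -scalerA -rE sE gE -scalerAr scalerAl; exact: (rdvd_mull _ (rdvd_refl g)).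
have [gp|/eqP] := part _ _ _ pE (dvdp_gcdl p q); last by rewrite (negPf cp0).
have [gq|/eqP] := part _ _ _ qE (dvdp_gcdr p q); last by rewrite (negPf cq0).
have [ccp ccq] := (cP c).1 (rdvd_refl c).
have mulZ (a b : R) (r s : {poly R}) : rdvd a b -> rdvd r s -> rdvd (a *: r) (b *: s).
  move=> [u ->] [v ->]; exists (u *: v).
  by rewrite -scalerAl -scalerAr scalerA mulrC scalerAl -scalerA.
exists (c *: g) => h; split=> [hcg|[hp hq]].
  by split; apply: (rdvd_trans hcg); rewrite ?pE ?qE; apply: mulZ.
have h0 : h != 0 by apply: contraNneq p0 => h0; case: hp => u ->; rewrite h0 mulr0.
have [ch [h1 [ch0 hE prim_h]]] := content h0.
have chr r cr r1 : r = cr *: r1 -> primitive r1 -> rdvd h r -> rdvd ch cr.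
  move=> rE prim [u uE]; apply: (primitive_cancel prim) => i.
  by rewrite -coefZ -rE uE hE -scalerAr coefZ; exact: rdvd_mulr (rdvd_refl ch).
rewrite hE; apply: mulZ; first by apply/cP; split; [exact: (chr _ _ _ pE)|exact: (chr _ _ _ qE)].
have dvd r : rdvd h r -> h %| r.
  by move=> [u ->]; apply: dvdp_mull; exact: dvdpp.
have : h %| gcdp p q by rewrite dvdp_gcd !dvd.
move=> /dvdpP[[k s] /= k0 sE].
apply: (@primitive_rdvdZ (k * cg)) => //; first by rewrite mulf_neq0.
by rewrite -scalerA -gE sE hE -scalerAr scalerAl; exact: (rdvd_mull _ (rdvd_refl h1)).
Qed.

End GaussLemma.

Lemma gcd_domain_iso (R S : nzRingType) (phi : {rmorphism R -> S}) (psi : {rmorphism S -> R}) :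
  cancel phi psi -> cancel psi phi -> gcd_domain R -> gcd_domain S.
Proof.
move=> phiK psiK gcdR a b; have [g gP] := gcdR (psi a) (psi b).
have dvdE x y : rdvd x (phi y) <-> rdvd (psi x) y.
  split=> -[c cE]; first by exists (psi c); rewrite -rmorphM -cE phiK.
  by exists (phi c); rewrite cE rmorphM psiK.
by exists (phi g) => h; rewrite dvdE gP -!dvdE !psiK.
Qed.

(** * Gcds of polynomials in several variables over a field *)

Section MpolyGcd.
Variable K : fieldType.

(** The inverse of [muni]; the isomorphism feeds the induction on the number of variables. *)
Definition mjoin n : {poly {mpoly K[n]}} -> {mpoly K[n.+1]} :=
  horner_eval 'X_ord_max \o @mpwiden n K.

HB.instance Definition _ n := GRing.RMorphism.copy (@mjoin n)
  (horner_eval ('X_ord_max : {mpoly K[n.+1]}) \o @mpwiden n K).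

Lemma muniX n (m : 'X_{1..n.+1}) :
  muni 'X_[K, m] = 'X_[[multinom (m (widen_ord (leqnSn n) i)) | i < n]] *: 'X^(m ord_max).
Proof. by rewrite muniE msuppX big_seq1 mcoeffX eqxx scale1r. Qed.

Lemma muniK n : cancel (@muni n K) (@mjoin n).
Proof.
move=> p; rewrite {1}[p]mpolyE (raddf_sum (@muni n K)) (raddf_sum (@mjoin n)) [RHS]mpolyE.
apply: eq_bigr => m _.
rewrite /= muniZ muniX /mjoin /= -!mul_polyC !rmorphM /= /mpwiden !map_polyC /= map_polyXn.
rewrite /horner_eval !hornerC hornerXn mwidenC mwidenX mul_mpolyC; congr (_ *: _).
rewrite mpolyXn -mpolyXD; congr 'X_[_]; apply/mnmP => i; rewrite mnmDE mulmnE mnm1E.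
case: (unliftP ord_max i) => [j ->|->]; last first.
  by rewrite mnmwiden_ordmax eqxx mul1n.
have -> : lift ord_max j = widen_ord (leqnSn n) j.
  by apply: val_inj; rewrite /= /bump leqNgt ltn_ord add0n.
rewrite mnmwiden_widen mnmE eqE /= gtn_eqF ?mul0n ?addn0 //.
Qed.

Lemma muni_mwiden n (p : {mpoly K[n]}) : muni (mwiden p) = p%:P.
Proof.
rewrite {1}[p]mpolyE (raddf_sum (@mwiden n K)) (raddf_sum (@muni n K)).
rewrite [in RHS](mpolyE p) raddf_sum; apply: eq_bigr => m _.
rewrite /= mwidenZ muniZ mwidenX muniX mnmwiden_ordmax expr0 alg_polyC -mul_polyC -polyCM.
rewrite mul_mpolyC; congr (_ *: 'X_[_])%:P; apply/mnmP => i.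
by rewrite mnmE mnmwiden_widen.
Qed.

Lemma mjoinK n : cancel (@mjoin n) (@muni n K).
Proof.
move=> p; rewrite -[p]coefK poly_def (raddf_sum (@mjoin n)) (raddf_sum (@muni n K)).
apply: eq_bigr => i _.
rewrite /= /mjoin /= -mul_polyC rmorphM /= /mpwiden map_polyC map_polyXn /horner_eval hornerM.
rewrite hornerC hornerXn muniM muni_mwiden rmorphXn /= muniX; congr (_ * _ ^+ _).
rewrite mnm1E eqxx expr1 -[RHS]scale1r; congr (_ *: _).
rewrite -mpolyX0; congr 'X_[_]; apply/mnmP => j; rewrite mnmE mnm1E mnm0E eqE /=.
by rewrite gtn_eqF.
Qed.

Lemma gcd_mpoly n : gcd_domain {mpoly K[n]}.
Proof.
elim: n => [|n IHn]; last exact: gcd_domain_iso (@mjoinK n) (@muniK n) (gcd_poly IHn).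
(* A polynomial in no variables is a constant, so it is zero or divides everything. *)
move=> p q; have unit_or (r : {mpoly K[0]}) : r = 0 \/ rdvd r 1.
  rewrite -[r]mpolyKC; have [->|r0] := eqVneq (r@_0%MM) 0; [by left|right].
  by exists (r@_0%MM)^-1%:MP; rewrite -mpolyCM mulVf // mpolyC1.
have dvd1 (r s : {mpoly K[0]}) : rdvd r 1 -> rdvd r s.
  by move=> [c cE]; exists (s * c); rewrite -mulrA -cE mulr1.
have [->|p1] := unit_or p.
  by exists q => h; split=> [?|[]//]; split=> //; exact: rdvd0.
exists p => h; split=> [hp|[]//]; split=> //; apply: dvd1; exact: rdvd_trans hp p1.
Qed.

End MpolyGcd.

(** * Syzygies of a vector with coprime entries *)

(** The indices are written with [lift] because [big_ord_recl] and [unliftP] produce these very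
    terms. *)
Local Notation o0 := (ord0 : 'I_3).
Local Notation o1 := (lift ord0 ord0 : 'I_3).
Local Notation o2 := (lift ord0 (lift ord0 ord0) : 'I_3).

Lemma ord3P (P : 'I_3 -> Prop) : P o0 -> P o1 -> P o2 -> forall i, P i.
Proof.
move=> P0 P1 P2 i; case: (unliftP ord0 i) => [j ->|-> //].
by case: (unliftP ord0 j) => [k ->|-> //]; rewrite ord1.
Qed.

Lemma sum3E (V : nmodType) (F : 'I_3 -> V) : \sum_i F i = F o0 + (F o1 + F o2).
Proof. by rewrite !big_ord_recl big_ord0 addr0. Qed.

Section Vectors.
Variable R : idomainType.
Implicit Types (u v w g : 'I_3 -> R) (a b c : R).

Definition dot u v := \sum_i u i * v i.

Definition cross u v : 'I_3 -> R := fun s =>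
  [:: u o1 * v o2 - u o2 * v o1; u o2 * v o0 - u o0 * v o2; u o0 * v o1 - u o1 * v o0]`_s.

Lemma dotE u v : dot u v = u o0 * v o0 + (u o1 * v o1 + u o2 * v o2).
Proof. exact: sum3E. Qed.

Lemma dot_comb1 a u v g :
  (forall s, v s = a * u s) -> dot v g = a * dot u g.
Proof. by move=> vE; rewrite !dotE !vE; ring. Qed.

Lemma dot_comb2 a1 a2 u1 u2 v g :
  (forall s, v s = a1 * u1 s + a2 * u2 s) -> dot v g = a1 * dot u1 g + a2 * dot u2 g.
Proof. by move=> vE; rewrite !dotE !vE; ring. Qed.

Lemma dot_comb3 a1 a2 a3 u1 u2 u3 v g :
  (forall s, v s = a1 * u1 s + a2 * u2 s + a3 * u3 s) ->
  dot v g = a1 * dot u1 g + a2 * dot u2 g + a3 * dot u3 g.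
Proof. by move=> vE; rewrite !dotE !vE; ring. Qed.

Lemma cross_eq0 u v : (forall s, cross u v s = 0) -> forall s t, u s * v t = u t * v s.
Proof.
move=> uv0; move: (uv0 o0) (uv0 o1) (uv0 o2) => /= /subr0_eq E0 /subr0_eq E1 /subr0_eq E2.
by apply: ord3P; apply: ord3P; rewrite ?E0 ?E1 ?E2.
Qed.

(** The triple product identity: (u x v) x g = (u . g) v - (v . g) u, whose coordinates give the
    coefficients passed to [E]. *)
Lemma cross_dot0 u v g : dot u g = 0 -> dot v g = 0 ->
  forall s t, cross u v s * g t = cross u v t * g s.
Proof.
rewrite !dotE => u0 v0.
have E k l (x y : R) : x - y = k * (u o0 * g o0 + (u o1 * g o1 + u o2 * g o2)) +
    l * (v o0 * g o0 + (v o1 * g o1 + v o2 * g o2)) -> x = y.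
  by rewrite u0 v0 !mulr0 addr0 => /subr0_eq.
apply: ord3P; apply: ord3P => //; rewrite /cross /=.
- by apply: (E (v o2) (- u o2)); ring.
- by apply: (E (- v o1) (u o1)); ring.
- by apply: (E (- v o2) (u o2)); ring.
- by apply: (E (v o0) (- u o0)); ring.
- by apply: (E (v o1) (- u o1)); ring.
- by apply: (E (- v o0) (u o0)); ring.
Qed.

(** Linearity of the cross product in its first argument; crossing a relation with one of its
    vectors is the way terms are eliminated below. *)
Lemma cross_comb3 a1 a2 a3 u1 u2 u3 v w :
  (forall s, v s = a1 * u1 s + a2 * u2 s + a3 * u3 s) ->
  forall s, cross v w s = a1 * cross u1 w s + a2 * cross u2 w s + a3 * cross u3 w s.
Proof. by move=> vE; apply: ord3P; rewrite /cross /= !vE; ring. Qed.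

Lemma cross_anti u v s : cross u v s = - cross v u s.
Proof. by move: s; apply: ord3P; rewrite /cross /=; ring. Qed.

Lemma cross_self u s : cross u u s = 0.
Proof. by move: s; apply: ord3P; rewrite /cross /=; ring. Qed.

(** [g s] divides [w s * g t] for every [t], and the [g t] are coprime, so it divides [w s]; the
    quotient then serves all coordinates. *)
Lemma parallel_coprime (gcdR : gcd_domain R) g w :
  (forall h, (forall s, rdvd h (g s)) -> h \is a GRing.unit) ->
  (exists s, g s != 0) -> (forall s t, w s * g t = w t * g s) ->
  exists h, forall s, w s = h * g s.
Proof.
move=> cop [s gs0] wg; have [h hE] : rdvd (g s) (w s).
  apply: (@coprime_cancel _ gcdR (codom g)) => [h hg|x].
    by apply: cop => t; apply: hg; exact: codom_f.
  move=> /codomP[t ->]; rewrite mulrC wg.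
  exact: (rdvd_mull _ (rdvd_refl _)).
exists h => t; apply: (mulIf gs0); rewrite -wg hE; ring.
Qed.

End Vectors.

(* The ring morphism aug plays the role of evaluation at the origin. *)
Section Minors.
Variables (R : idomainType) (K : nzRingType) (aug : {rmorphism R -> K}).
Variables (g r1 r2 r3 : 'I_3 -> R).
Hypothesis gcdR : gcd_domain R.
Hypothesis g_neq0 : exists s, g s != 0.
Hypothesis g_coprime : forall h, (forall s, rdvd h (g s)) -> h \is a GRing.unit.
Hypothesis gen : forall v, dot v g = 0 ->
  exists a1 a2 a3, forall s, v s = a1 * r1 s + a2 * r2 s + a3 * r3 s.
Hypotheses (r1g : dot r1 g = 0) (r2g : dot r2 g = 0) (r3g : dot r3 g = 0).

Definition relation a1 a2 a3 := forall s, a1 * r1 s + a2 * r2 s + a3 * r3 s = 0.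

Hypothesis min_gen : forall a1 a2 a3, relation a1 a2 a3 ->
  [/\ aug a1 = 0, aug a2 = 0 & aug a3 = 0].

Lemma minors_exist : exists c1 c2 c3,
  [/\ forall s, cross r2 r3 s = c1 * g s, forall s, cross r3 r1 s = c2 * g s &
      forall s, cross r1 r2 s = c3 * g s].
Proof.
have par u v : dot u g = 0 -> dot v g = 0 -> exists c, forall s, cross u v s = c * g s.
  by move=> ug vg; apply: parallel_coprime => //; exact: cross_dot0.
have [c1 c1E] := par _ _ r2g r3g; have [c2 c2E] := par _ _ r3g r1g.
have [c3 c3E] := par _ _ r1g r2g.
by exists c1, c2, c3.
Qed.

Variables c1 c2 c3 : R.
Hypotheses (c1E : forall s, cross r2 r3 s = c1 * g s)
  (c2E : forall s, cross r3 r1 s = c2 * g s) (c3E : forall s, cross r1 r2 s = c3 * g s).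

(** Let M have rows r1, r2, r3. Times [g t], the left side becomes an entry of adj(M) M, which is
    zero off the diagonal and det M on it; det M vanishes because M kills the nonzero vector g. *)
Lemma minors_relation : relation c1 c2 c3.
Proof.
have [t gt0] := g_neq0 => s; apply: (mulIf gt0); rewrite mul0r !mulrDl.
have -> : c1 * r1 s * g t = cross r2 r3 t * r1 s by rewrite c1E; ring.
have -> : c2 * r2 s * g t = cross r3 r1 t * r2 s by rewrite c2E; ring.
have -> : c3 * r3 s * g t = cross r1 r2 t * r3 s by rewrite c3E; ring.
have det0 : cross r2 r3 t * dot r1 g + cross r3 r1 t * dot r2 g + cross r1 r2 t * dot r3 g = 0.
  by rewrite r1g r2g r3g !mulr0 !addr0.
apply: (mulIf gt0); rewrite mul0r; move: det0; rewrite !dotE; move: s t {gt0}.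
apply: ord3P; apply: ord3P; rewrite /cross /= => det0.
all: first [ring | by rewrite -[RHS]det0; ring].
Qed.

(** Crossing the relation with r3, r1 and r2 removes one term each time and leaves multiples of g.
    This gives proportionality to c only; being a multiple of c needs more. *)
Lemma relation_cross a1 a2 a3 : relation a1 a2 a3 ->
  [/\ a1 * c2 = a2 * c1, a2 * c3 = a3 * c2 & a3 * c1 = a1 * c3].
Proof.
move=> ra; have [t gt0] := g_neq0.
have E w := cross_comb3 (v := fun=> 0) w (fun s => esym (ra s)) t.
have c0 (w : 'I_3 -> R) : cross (fun=> 0) w t = 0.
  by move: t {E gt0}; apply: ord3P; rewrite /cross /=; ring.
split; apply: (mulIf gt0); apply/eqP; rewrite -subr_eq0; apply/eqP.
- rewrite -[RHS]oppr0 -(c0 r3) E cross_self (cross_anti r1 r3) c1E c2E; ring.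
- rewrite -[RHS]oppr0 -(c0 r1) E cross_self (cross_anti r2 r1) c2E c3E; ring.
- rewrite -[RHS]oppr0 -(c0 r2) E cross_self (cross_anti r3 r2) c1E c3E; ring.
Qed.

Lemma relation_scaleI a a1 a2 a3 : a != 0 ->
  relation (a * a1) (a * a2) (a * a3) -> relation a1 a2 a3.
Proof.
move=> a0 ra s; apply: (mulfI a0); rewrite mulr0 -(ra s); ring.
Qed.

(** If all ci vanished, any two syzygies would be parallel, but the cross products of the Koszul
    syzygies of g have the squares of its entries among their coordinates. *)
Lemma minors_not_all0 : ~ [/\ c1 = 0, c2 = 0 & c3 = 0].
Proof.
move=> [c10 c20 c30]; have [t gt0] := g_neq0.
have r0 u w : dot u g = 0 -> dot w g = 0 -> forall s, cross u w s = 0.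
  move=> /gen[a1 [a2 [a3 uE]]] /gen[b1 [b2 [b3 wE]]] s.
  rewrite (cross_comb3 _ uE) ![cross _ w s]cross_anti !(cross_comb3 _ wE) !cross_self.
  rewrite (cross_anti r2 r1) (cross_anti r3 r2) (cross_anti r1 r3) c1E c2E c3E c10 c20 c30.
  ring.
pose k (x y z : R) : 'I_3 -> R := fun s => [:: x; y; z]`_s.
have k1g : dot (k (g o1) (- g o0) 0) g = 0 by rewrite dotE /k /=; ring.
have k2g : dot (k (g o2) 0 (- g o0)) g = 0 by rewrite dotE /k /=; ring.
have k3g : dot (k 0 (g o2) (- g o1)) g = 0 by rewrite dotE /k /=; ring.
have g00 : g o0 = 0.
  by apply/eqP; rewrite -sqrf_eq0 -(r0 _ _ k1g k2g o0) /cross /k /=; apply/eqP; ring.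
have g10 : g o1 = 0.
  by apply/eqP; rewrite -sqrf_eq0 -(r0 _ _ k1g k3g o1) /cross /k /=; apply/eqP; ring.
have g20 : g o2 = 0.
  by apply/eqP; rewrite -sqrf_eq0 -(r0 _ _ k2g k3g o2) /cross /k /=; apply/eqP; ring.
by case/negP: gt0; apply/eqP; move: t; apply: ord3P.
Qed.

(* If r1 and r2 were parallel, both would be multiples of some syzygy w, which would itself be a
   combination of r1 and r2. *)
Lemma last_minor_neq0 : c3 != 0.
Proof.
apply/eqP => c30; have nall := minors_not_all0.
have [s r1s] : exists s, r1 s != 0.
  have [//|r10] := pselect (exists s, r1 s != 0).
  have : relation 1 0 0.
    move=> s; rewrite !mul0r !addr0 mul1r; apply/eqP/negPn/negP => r1s.
    by apply: r10; exists s.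
  by move=> /min_gen[/eqP]; rewrite rmorph1 oner_eq0.
have r12 := cross_eq0 (fun s => etrans (c3E s) (etrans (congr1 (fun x => x * g s) c30) (mul0r _))).
have [h [u [v [h0 uE vE cop]]]] : exists h u v, [/\ h != 0, r2 s = u * h, r1 s = v * h &
    forall k, rdvd k u -> rdvd k v -> k \is a GRing.unit].
  by apply: (gcd_factor gcdR); rewrite r1s orbT.
have v0 : v != 0 by apply: contraNneq r1s => v0; rewrite vE v0 mul0r.
have uvr t : u * r1 t = v * r2 t.
  by apply: (mulIf h0); rewrite mulrAC -uE mulrAC -vE mulrC -r12 mulrC.
have /fin_all_exists[w wE] : forall t, exists w, r1 t = w * v.
  move=> t; apply: (coprime_cancel2 gcdR (b := u)) => [k kv ku|]; first exact: cop.
  by rewrite uvr; exact: (rdvd_mulr _ (rdvd_refl v)).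
have r2E t : r2 t = u * w t.
  by apply: (mulfI v0); rewrite -uvr wE; ring.
have uv_rel : relation u (- v) 0 by move=> t; rewrite uvr; ring.
have wg : dot w g = 0.
  apply: (mulfI v0); rewrite mulr0 -r1g; apply/esym/dot_comb1 => t.
  by rewrite wE mulrC.
have [e1 [e2 [e3 eE]]] := gen wg.
have wcross p q : (forall s, q s = p * w s) -> forall s, cross w q s = 0.
  move=> qE t; rewrite cross_anti (cross_comb3 (a1 := p) (a2 := 0) (a3 := 0) (u1 := w)
    (u2 := w) (u3 := w)) ?cross_self ?mulr0 ?addr0 ?oppr0 //.
  by move=> t'; rewrite qE; ring.
(* Crossing [w] with the parallel vectors [r2] and [r1] leaves [e3 * c1] and [e3 * c2], so a nonzero
   [e3] would make all three minors vanish. *)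
have e30 : e3 = 0.
  have [t gt0] := g_neq0; apply/eqP; apply/negPn/negP => e30; apply: nall; split=> //.
    apply: (mulIf gt0); apply: (mulfI e30); rewrite mul0r mulr0.
    rewrite -[RHS]oppr0 -(wcross _ _ r2E t) (cross_comb3 _ eE) cross_self (cross_anti r3 r2).
    rewrite c1E c3E c30; ring.
  apply: (mulIf gt0); apply: (mulfI e30); rewrite mul0r mulr0.
  have r1E t' : r1 t' = v * w t' by rewrite wE mulrC.
  rewrite -(wcross _ _ r1E t) (cross_comb3 _ eE) cross_self (cross_anti r2 r1) c2E c3E c30.
  ring.
have ws : w s != 0 by apply: contraNneq r1s => ws; rewrite wE ws mul0r.
(* Here w = (e1 v + e2 u) w, whereas minimality applied to u r1 - v r2 = 0 puts u and v in the
   kernel of [aug], which would then contain 1. *)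
have : e1 * v + e2 * u = 1.
  by apply: (mulIf ws); rewrite mul1r {2}eE e30 r2E wE; ring.
have [u0 /eqP] := min_gen uv_rel; rewrite rmorphN oppr_eq0 => /eqP v00 _.
by move/(congr1 aug); rewrite rmorphD !rmorphM u0 v00 !mulr0 addr0 rmorph1 => /eqP;
  rewrite eq_sym oner_eq0.
Qed.

End Minors.

(** * The Koszul complex of the relation *)

(* The endomorphism phi picks a representative modulo c3. *)
Section Koszul.
Variables (R : idomainType) (phi : {rmorphism R -> R}).
Variables (g r1 r2 r3 : 'I_3 -> R) (c1 c2 c3 : R).
Hypothesis gcdR : gcd_domain R.
Hypothesis gen : forall v, dot v g = 0 ->
  exists a1 a2 a3, forall s, v s = a1 * r1 s + a2 * r2 s + a3 * r3 s.
Hypotheses (r1g : dot r1 g = 0) (r2g : dot r2 g = 0) (r3g : dot r3 g = 0).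
Hypothesis rel_c : relation r1 r2 r3 c1 c2 c3.
Hypothesis rel_cross : forall a1 a2 a3, relation r1 r2 r3 a1 a2 a3 ->
  [/\ a1 * c2 = a2 * c1, a2 * c3 = a3 * c2 & a3 * c1 = a1 * c3].
Hypothesis min_gen3 : forall a1 a2, ~ relation r1 r2 r3 a1 a2 1.
Hypothesis c3_neq0 : c3 != 0.
Hypothesis phi_c3 : phi c3 = 0.
Hypothesis phiE : forall p, exists s, p = phi p + s * c3.

Lemma phi_idem p : phi (phi p) = phi p.
Proof.
have [s sE] := phiE p.
by rewrite {2}sE rmorphD rmorphM phi_c3 mulr0 addr0.
Qed.

(** With [phi_c3] it identifies the kernel of [phi] with the ideal of [c3], so the image of [phi] is
    a copy of R/(c3) inside a domain. *)
Lemma phi0_dvd p : phi p = 0 -> exists s, p = s * c3.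
Proof. by move=> p0; have [s ->] := phiE p; exists s; rewrite p0 add0r. Qed.

(** If c3 divided both c1 and c2, dividing the relation by c3 would give one with third coefficient
    1, against minimality. *)
Lemma phi_c_neq0 : (phi c1 != 0) || (phi c2 != 0).
Proof.
rewrite -negb_and; apply/negP => /andP[/eqP/phi0_dvd[s1 s1E] /eqP/phi0_dvd[s2 s2E]].
apply: (min_gen3 (a1 := s1) (a2 := s2)).
apply: (relation_scaleI c3_neq0) => s; rewrite -(rel_c s) s1E s2E; ring.
Qed.

(** Exactness of the Koszul complex where (a1, a2, a3) x c = 0. Modulo [c3], [a3] kills [c1] and
    [c2], which are not both zero there, so [c3] divides [a3]. *)
Lemma koszul1 a1 a2 a3 : a1 * c2 = a2 * c1 -> a2 * c3 = a3 * c2 -> a3 * c1 = a1 * c3 ->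
  exists t, [/\ a1 = t * c1, a2 = t * c2 & a3 = t * c3].
Proof.
move=> E3 E1 E2.
have /phi0_dvd[t tE] : phi a3 = 0.
  apply/eqP/negPn/negP => a30; have := phi_c_neq0.
  have /eqP : phi a3 * phi c1 = 0 by rewrite -rmorphM E2 rmorphM phi_c3 mulr0.
  have /eqP : phi a3 * phi c2 = 0 by rewrite -rmorphM -E1 rmorphM phi_c3 mulr0.
  by rewrite !mulf_eq0 (negPf a30) /= => -> ->.
exists t; split=> //; apply: (mulIf c3_neq0).
  by rewrite -E2 tE; ring.
by rewrite E1 tE; ring.
Qed.

Lemma relation_multiple a1 a2 a3 : relation r1 r2 r3 a1 a2 a3 ->
  exists t, [/\ a1 = t * c1, a2 = t * c2 & a3 = t * c3].
Proof. by move=> /rel_cross[*]; apply: koszul1. Qed.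

(* Writing ci = x ai + y bi, the syzygy sum ai ri is divisible by y and sum bi ri by x, which
   yields two relations; these are multiples of (c1, c2, c3). *)
Lemma regular_pair_unit x y a1 a2 a3 b1 b2 b3 : y != 0 ->
  (forall p q, x * p = y * q -> exists w, p = y * w /\ q = x * w) ->
  c1 = x * a1 + y * b1 -> c2 = x * a2 + y * b2 -> c3 = x * a3 + y * b3 ->
  exists al be, al * x + be * y = 1.
Proof.
move=> y0 reg c1E c2E c3E.
have /fin_all_exists[w wE] : forall s, exists w,
    a1 * r1 s + a2 * r2 s + a3 * r3 s = y * w /\
    - (b1 * r1 s + b2 * r2 s + b3 * r3 s) = x * w.
  move=> s; apply: reg; apply/eqP; rewrite -subr_eq0 -(rel_c s) c1E c2E c3E; apply/eqP; ring.
have wg : dot w g = 0.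
  apply: (mulfI y0); rewrite mulr0.
  have <- : dot (fun s => a1 * r1 s + a2 * r2 s + a3 * r3 s) g = y * dot w g.
    by apply: dot_comb1 => s; case: (wE s).
  by rewrite (dot_comb3 (a1 := a1) (a2 := a2) (a3 := a3) (u1 := r1) (u2 := r2) (u3 := r3)) //
     r1g r2g r3g !mulr0 !addr0.
have [e1 [e2 [e3 eE]]] := gen wg.
have rel_a : relation r1 r2 r3 (a1 - y * e1) (a2 - y * e2) (a3 - y * e3).
  move=> s; have [E _] := wE s; rewrite eE in E.
  by apply/eqP; rewrite -[X in _ == X](subrr (a1 * r1 s + a2 * r2 s + a3 * r3 s)) {2}E;
    apply/eqP; ring.
have rel_b : relation r1 r2 r3 (b1 + x * e1) (b2 + x * e2) (b3 + x * e3).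
  move=> s; have [_ E] := wE s; rewrite eE in E.
  by apply/eqP; rewrite -[X in _ == X](subrr (x * (e1 * r1 s + e2 * r2 s + e3 * r3 s))) -{2}E;
    apply/eqP; ring.
have [al [_ _ alE]] := relation_multiple rel_a.
have [be [_ _ beE]] := relation_multiple rel_b.
(* In x (a3 - y e3) + y (b3 + x e3) the terms in [e3] cancel and [c3] remains; both brackets are
   multiples of [c3]. *)
exists al, be; apply: (mulIf c3_neq0); rewrite mul1r.
have -> : (al * x + be * y) * c3 = x * (al * c3) + y * (be * c3) by ring.
by rewrite -alE -beE [RHS]c3E; ring.
Qed.

(** A gcd [h] of [phi c1] and [phi c2] forms with [c3] a pair as in [regular_pair_unit], so [phi h]
    is invertible with inverse [phi be]. The coprime cofactors u, v then agree modulo [c3] with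
    [phi c1], [phi c2] up to this factor. *)
Lemma phi_coprime p q : phi c1 * phi p = phi c2 * phi q ->
  exists w, phi p = phi c2 * phi w /\ phi q = phi c1 * phi w.
Proof.
have [h [u [v [h0 uE vE cop]]]] := gcd_factor gcdR phi_c_neq0.
have phih : phi h != 0.
  have := phi_c_neq0; apply: contraTneq => h0'.
  by rewrite -[phi c1]phi_idem -[phi c2]phi_idem uE vE !rmorphM h0' !mulr0 eqxx.
have [al [be ab1]] : exists al be, al * c3 + be * h = 1.
  have [s1 s1E] := phiE c1; have [s2 s2E] := phiE c2.
  apply: (@regular_pair_unit c3 h s1 s2 1 u v 0) => //.
  - move=> p' q' pq; have /phi0_dvd[w wE] : phi q' = 0.
      apply: (mulfI phih); rewrite -rmorphM -pq rmorphM phi_c3; ring.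
    exists w; split; last by rewrite wE mulrC.
    by apply: (mulfI c3_neq0); rewrite pq wE; ring.
  - by rewrite {1}s1E uE; ring.
  - by rewrite {1}s2E vE; ring.
  - by ring.
have be1 : phi be * phi h = 1.
  by rewrite -(rmorph1 phi) -ab1 rmorphD !rmorphM phi_c3 mulr0 add0r.
move=> E; have {}E : u * phi p = v * phi q.
  by apply: (mulIf h0); rewrite mulrAC -uE E vE; ring.
have [w [wp wq]] : exists w, phi p = v * w /\ phi q = u * w.
  have [v0|v0] := eqVneq v 0.
    have uu : u \is a GRing.unit by apply: cop => //; rewrite ?v0; [exact: rdvd_refl|exact: rdvd0].
    have u0 : u != 0 by apply: contraTneq uu => ->; rewrite unitr0.
    exists (u^-1 * phi q); rewrite v0 mulVKr // mul0r; split=> //.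
    by apply: (mulfI u0); rewrite E v0; ring.
  have [w wE] : rdvd v (phi p).
    apply: (coprime_cancel2 gcdR (b := u)) => [k kv ku|]; first exact: cop.
    by rewrite E; exact: (rdvd_mulr _ (rdvd_refl v)).
  exists w; split; first by rewrite wE mulrC.
  by apply: (mulfI v0); rewrite -E wE; ring.
have phic x y : phi x = y * h -> phi y = phi x * phi be.
  by move=> xE; rewrite -[phi x]phi_idem xE rmorphM -mulrA [phi h * _]mulrC be1 mulr1.
exists (be * w); rewrite rmorphM; split.
  by rewrite -phi_idem wp rmorphM (phic _ _ vE); ring.
by rewrite -phi_idem wq rmorphM (phic _ _ uE); ring.
Qed.

(** Modulo [c3], coprimality makes (a1, a2) a multiple [w] of (c2, -c1). The two remainders,
    divisible by [c3], supply b1 and b2, and the third equation follows by cancelling [c3]. *)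
Lemma koszul2 a1 a2 a3 : c1 * a1 + c2 * a2 + c3 * a3 = 0 ->
  exists b1 b2 b3, [/\ a1 = c2 * b3 - c3 * b2, a2 = c3 * b1 - c1 * b3 & a3 = c1 * b2 - c2 * b1].
Proof.
move=> E.
have [w [w1 w2]] : exists w, phi a1 = phi c2 * phi w /\ phi (- a2) = phi c1 * phi w.
  apply: phi_coprime; rewrite -!rmorphM; apply/eqP; rewrite -subr_eq0 -rmorphB.
  have -> : c1 * a1 - c2 * - a2 = - (c3 * a3).
    by apply/eqP; rewrite -addr_eq0 -E; apply/eqP; ring.
  by rewrite rmorphN rmorphM phi_c3 mul0r oppr0.
have [|s1 s1E] := @phi0_dvd (a1 - c2 * w); first by rewrite rmorphB w1 rmorphM subrr.
have [|s2 s2E] := @phi0_dvd (a2 + c1 * w).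
  by rewrite rmorphD rmorphM -w2 rmorphN subrr.
have a1E : a1 = c2 * w - c3 * - s1 by rewrite mulrN opprK [c3 * _]mulrC -s1E; ring.
have a2E : a2 = c3 * s2 - c1 * w by rewrite [c3 * _]mulrC -s2E; ring.
exists s2, (- s1), w; split=> //; apply: (mulfI c3_neq0); apply/eqP.
by rewrite -subr_eq0 -E a1E a2E; apply/eqP; ring.
Qed.

(** * The ideal generated by g and p0 *)

Section Generator.
Variables (A1 A2 A3 : 'I_3 -> R) (p0 : R).
Hypothesis r1E : forall s, r1 s = c2 * A3 s - c3 * A2 s.
Hypothesis r2E : forall s, r2 s = c3 * A1 s - c1 * A3 s.
Hypothesis r3E : forall s, r3 s = c1 * A2 s - c2 * A1 s.
Hypotheses (A1g : dot A1 g = p0 * c1) (A2g : dot A2 g = p0 * c2) (A3g : dot A3 g = p0 * c3).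

(** If t p0 = B . g, then ci B - t Ai is a syzygy of g. Combining the cases i = 1, 2 so that B
    cancels leaves t r3 and hence a relation, whose third entry must be a multiple of c3. *)
Lemma ann_generator t : (exists B, t * p0 = dot B g) <->
  (exists t1 t2 t3, t = t1 * c1 + t2 * c2 + t3 * c3).
Proof.
split=> [[B BE]|[t1 [t2 [t3 ->]]]]; last first.
  exists (fun s => t1 * A1 s + t2 * A2 s + t3 * A3 s).
  by rewrite (dot_comb3 (a1 := t1) (a2 := t2) (a3 := t3) (u1 := A1) (u2 := A2) (u3 := A3)) //
     A1g A2g A3g; ring.
have syz c (A : 'I_3 -> R) : dot A g = p0 * c -> exists e1 e2 e3,
    forall s, c * B s - t * A s = e1 * r1 s + e2 * r2 s + e3 * r3 s.
  move=> Ag; apply: gen.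
  by rewrite (dot_comb2 (a1 := c) (a2 := - t) (u1 := B) (u2 := A)) ?Ag -?BE => [|s]; ring.
have [e1 [e2 [e3 eE]]] := syz _ _ A1g; have [f1 [f2 [f3 fE]]] := syz _ _ A2g.
have : relation r1 r2 r3 (c2 * e1 - c1 * f1) (c2 * e2 - c1 * f2) (c2 * e3 - c1 * f3 - t).
  move=> s; transitivity (c2 * (e1 * r1 s + e2 * r2 s + e3 * r3 s) -
    c1 * (f1 * r1 s + f2 * r2 s + f3 * r3 s) - t * r3 s); first by ring.
  by rewrite -eE -fE r3E; ring.
move=> /relation_multiple[w [_ _ /eqP]]; rewrite subr_eq => /eqP E.
exists (- f3), e3, (- w); transitivity (w * c3 + t - w * c3); first by ring.
by rewrite -E; ring.
Qed.

Lemma generator_syzygies B b : dot B g + b * p0 = 0 -> exists e1 e2 e3,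
  (forall s, B s = e1 * A1 s + e2 * A2 s + e3 * A3 s) /\ b = - (e1 * c1 + e2 * c2 + e3 * c3).
Proof.
move=> E; have [|t1 [t2 [t3 tE]]] := (ann_generator (- b)).1.
  by exists B; apply/eqP; rewrite -subr_eq0 -oppr_eq0 -E; apply/eqP; ring.
have [|e1 [e2 [e3 eE]]] := @gen (fun s => B s - (t1 * A1 s + t2 * A2 s + t3 * A3 s)).
  rewrite (dot_comb2 (a1 := 1) (a2 := -1) (u1 := B)
    (u2 := fun s => t1 * A1 s + t2 * A2 s + t3 * A3 s)); last by move=> s; ring.
  rewrite (dot_comb3 (v := fun s => t1 * A1 s + t2 * A2 s + t3 * A3 s) _ (fun=> erefl)).
  by rewrite A1g A2g A3g -[RHS]E -[b]opprK tE; ring.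
(* Substituting r = c x A turns the coefficients e into e x c on the Ai; this is orthogonal to c, so
   [b] is unchanged. *)
exists (t1 + (e2 * c3 - e3 * c2)), (t2 + (e3 * c1 - e1 * c3)), (t3 + (e1 * c2 - e2 * c1)).
split=> [s|]; last by rewrite -[b]opprK tE; ring.
have /eqP := eE s; rewrite subr_eq => /eqP->; rewrite r1E r2E r3E; ring.
Qed.

(** By [koszul2], t = c x b; then t . A = - b . r, so b is a relation, a multiple of c, and t
    vanishes. *)
Lemma generator_syzygies_free t1 t2 t3 :
  (forall s, t1 * A1 s + t2 * A2 s + t3 * A3 s = 0) -> t1 * c1 + t2 * c2 + t3 * c3 = 0 ->
  [/\ t1 = 0, t2 = 0 & t3 = 0].
Proof.
move=> tA tc; have [|b1 [b2 [b3 [t1E t2E t3E]]]] := @koszul2 t1 t2 t3.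
  by rewrite -tc; ring.
have /relation_multiple[w [w1 w2 w3]] : relation r1 r2 r3 b1 b2 b3.
  move=> s; rewrite -[RHS]oppr0 -(tA s) t1E t2E t3E r1E r2E r3E; ring.
by rewrite t1E t2E t3E w1 w2 w3; split; ring.
Qed.

(* By [generator_syzygies] and [generator_syzygies_free], the ideal (g, p0) has a free resolution
   of length 2 (Hilbert-Burch), so it is saturated. *)
Lemma generator_saturated p :
  (exists B b, c1 * p = dot B g + b * p0) -> (exists B b, c2 * p = dot B g + b * p0) ->
  (exists B b, c3 * p = dot B g + b * p0) -> exists B b, p = dot B g + b * p0.
Proof.
move=> [a1 [b1 E1]] [a2 [b2 E2]] [a3 [b3 E3]].
have syz c c' (a a' : 'I_3 -> R) b b' : c * p = dot a g + b * p0 -> c' * p = dot a' g + b' * p0 ->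
    exists e1 e2 e3, (forall s, c * a' s - c' * a s = e1 * A1 s + e2 * A2 s + e3 * A3 s) /\
      c * b' - c' * b = - (e1 * c1 + e2 * c2 + e3 * c3).
  move=> E E'; apply: generator_syzygies.
  rewrite (dot_comb2 (a1 := c) (a2 := - c') (u1 := a') (u2 := a)); last by move=> s; ring.
  rewrite -(subrr (c * (c' * p))) {1}E' [c * (c' * p)]mulrCA E; ring.
have [e11 [e12 [e13 [e1E e1c]]]] := syz _ _ _ _ _ _ E2 E3.
have [e21 [e22 [e23 [e2E e2c]]]] := syz _ _ _ _ _ _ E3 E1.
have [e31 [e32 [e33 [e3E e3c]]]] := syz _ _ _ _ _ _ E1 E2.
(* The three syzygies are the entries of a cross product with c, so contracting them with c gives 0;
   by freeness the same holds for their coefficients. *)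
have [] := @generator_syzygies_free (c1 * e11 + c2 * e21 + c3 * e31)
  (c1 * e12 + c2 * e22 + c3 * e32) (c1 * e13 + c2 * e23 + c3 * e33).
- move=> s; have <- : c1 * (c2 * a3 s - c3 * a2 s) + c2 * (c3 * a1 s - c1 * a3 s) +
      c3 * (c1 * a2 s - c2 * a1 s) = 0 by ring.
  by rewrite e1E e2E e3E; ring.
- rewrite -[RHS]oppr0; have <- : c1 * (c2 * b3 - c3 * b2) + c2 * (c3 * b1 - c1 * b3) +
      c3 * (c1 * b2 - c2 * b1) = 0 by ring.
  by rewrite e1c e2c e3c; ring.
move=> /koszul2[f11 [f12 [f13 [e11E e21E e31E]]]].
move=> /koszul2[f21 [f22 [f23 [e12E e22E e32E]]]].
move=> /koszul2[f31 [f32 [f33 [e13E e23E e33E]]]].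
(* These corrections make the three expressions of the ci p strictly compatible, ci aj' = cj ai', so
   that [koszul1] divides them by c. *)
pose a1' s := a1 s - (f11 * A1 s + f21 * A2 s + f31 * A3 s).
pose a2' s := a2 s - (f12 * A1 s + f22 * A2 s + f32 * A3 s).
pose a3' s := a3 s - (f13 * A1 s + f23 * A2 s + f33 * A3 s).
pose b3' := b3 + (f13 * c1 + f23 * c2 + f33 * c3).
have sub0 (x y : R) : x - y = 0 -> x = y by move=> /subr0_eq.
have /fin_all_exists[B BE] : forall s, exists t,
    [/\ a1' s = t * c1, a2' s = t * c2 & a3' s = t * c3].
  move=> s; apply: koszul1; apply: sub0; rewrite /a1' /a2' /a3'.
  - transitivity (- ((c1 * a2 s - c2 * a1 s) - (e31 * A1 s + e32 * A2 s + e33 * A3 s))); last first.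
      by rewrite e3E subrr oppr0.
    by rewrite e31E e32E e33E; ring.
  - transitivity (- ((c2 * a3 s - c3 * a2 s) - (e11 * A1 s + e12 * A2 s + e13 * A3 s))); last first.
      by rewrite e1E subrr oppr0.
    by rewrite e11E e12E e13E; ring.
  - transitivity (- ((c3 * a1 s - c1 * a3 s) - (e21 * A1 s + e22 * A2 s + e23 * A3 s))); last first.
      by rewrite e2E subrr oppr0.
    by rewrite e21E e22E e23E; ring.
pose b1' := b1 + (f11 * c1 + f21 * c2 + f31 * c3).
pose b2' := b2 + (f12 * c1 + f22 * c2 + f32 * c3).
have [b [_ _ bE]] : exists t, [/\ b1' = t * c1, b2' = t * c2 & b3' = t * c3].
  apply: koszul1; apply: sub0; rewrite /b1' /b2' /b3'.
  - transitivity (- ((c1 * b2 - c2 * b1) + (e31 * c1 + e32 * c2 + e33 * c3))); last first.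
      by rewrite e3c addNr oppr0.
    by rewrite e31E e32E e33E; ring.
  - transitivity (- ((c2 * b3 - c3 * b2) + (e11 * c1 + e12 * c2 + e13 * c3))); last first.
      by rewrite e1c addNr oppr0.
    by rewrite e11E e12E e13E; ring.
  - transitivity (- ((c3 * b1 - c1 * b3) + (e21 * c1 + e22 * c2 + e23 * c3))); last first.
      by rewrite e2c addNr oppr0.
    by rewrite e21E e22E e23E; ring.
exists B, b; apply: (mulfI c3_neq0).
have a3E s : a3 s = 1 * a3' s + 1 * (f13 * A1 s + f23 * A2 s + f33 * A3 s).
  by rewrite /a3'; ring.
rewrite E3 (dot_comb2 _ a3E).
rewrite (dot_comb3 (v := fun s => f13 * A1 s + f23 * A2 s + f33 * A3 s) _ (fun=> erefl)).
have -> : dot a3' g = c3 * dot B g.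
  by apply: dot_comb1 => s; have [_ _ ->] := BE s; rewrite mulrC.
have -> : b3 = b * c3 - (f13 * c1 + f23 * c2 + f33 * c3) by rewrite -bE /b3'; ring.
by rewrite A1g A2g A3g; ring.
Qed.

End Generator.
End Koszul.

(** * Homogeneous components and the gradient of a reduced form *)

Section GradedRing.
Variable K : fieldType.
Local Notation S := {mpoly K[3]}.
Implicit Types (p q : S) (k a b : int).

Lemma homog_atP k p : reflect (forall m, p@_m != 0 -> (mdeg m)%:Z = k) (homog_at k p).
Proof.
case: k => k /=.
  apply: (iffP (dhomogP mdeg k p)) => hp m; first by rewrite -mcoeff_msupp => /hp ->.
  by rewrite mcoeff_msupp => /hp [].
apply: (iffP eqP) => [-> m|hp]; first by rewrite mcoeff0 eqxx.
apply/mpolyP => m; rewrite mcoeff0; apply/eqP/negPn/negP => /hp; lia.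
Qed.

Lemma homog_at0 k : homog_at k (0 : S).
Proof. by apply/homog_atP => m; rewrite mcoeff0 eqxx. Qed.

Lemma homog_atD k p q : homog_at k p -> homog_at k q -> homog_at k (p + q).
Proof. by move=> hp hq; rewrite -[p]scale1r; exact: homog_at_lin. Qed.

Lemma homog_atN k p : homog_at k p -> homog_at k (- p).
Proof. by move=> /homog_atP hp; apply/homog_atP => m; rewrite mcoeffN oppr_eq0 => /hp. Qed.

Lemma homog_atB k p q : homog_at k p -> homog_at k q -> homog_at k (p - q).
Proof. by move=> hp hq; apply: homog_atD => //; exact: homog_atN. Qed.

Lemma homog_atZ k (c : K) p : homog_at k p -> homog_at k (c *: p).
Proof. by move=> hp; rewrite -[_ *: _]addr0; exact/homog_at_lin/homog_at0. Qed.

Lemma homog_at_sum k I (r : seq I) (P : pred I) (F : I -> S) :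
  (forall i, P i -> homog_at k (F i)) -> homog_at k (\sum_(i <- r | P i) F i).
Proof. by move=> hF; elim/big_ind: _ => [||//]; [exact: homog_at0|exact: homog_atD]. Qed.

Lemma homog_atX m : homog_at (mdeg m) ('X_[m] : S).
Proof. by apply/homog_atP => m'; rewrite mcoeffX; case: (m =P m') => [->|_]; rewrite ?eqxx. Qed.

Lemma homog_atM a b p q : homog_at a p -> homog_at b q -> homog_at (a + b) (p * q).
Proof.
move=> /homog_atP hp /homog_atP hq; apply/homog_atP => m.
rewrite -mcoeff_msupp => /msuppM_le /allpairsP[[m1 m2] /= [m1p m2q ->]].
by rewrite -(hp m1) -?mcoeff_msupp // -(hq m2) -?mcoeff_msupp // mdegD.
Qed.

Definition hcomp k p : S := if k is Posz n then pihomog mdeg n p else 0.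

Lemma hcomp_homog k p : homog_at k (hcomp k p).
Proof. by case: k => k /=; [exact: pihomogP|]. Qed.

Lemma hcomp_is_linear k : linear (hcomp k).
Proof. by case: k => k c p q /=; [rewrite linearP|rewrite scaler0 addr0]. Qed.

HB.instance Definition _ k := GRing.isLinear.Build K S S _ (hcomp k) (hcomp_is_linear k).

Lemma hcomp_id k p : homog_at k p -> hcomp k p = p.
Proof. by case: k => k /= => [/pihomog_dE|/eqP->]. Qed.

Lemma hcomp_ne a b p : homog_at a p -> a != b -> hcomp b p = 0.
Proof.
case: a b => a [b|b] //= => [hp ab|/eqP-> _]; last by rewrite pihomog0.
by apply: pihomog_ne0 hp.
Qed.

(** Projects identities with homogeneous coefficients onto one degree, so that witnesses can be
    taken homogeneous. *)
Lemma hcompM k a p q : homog_at a q -> hcomp k (p * q) = hcomp (k - a) p * q.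
Proof.
move=> hq; rewrite {1}[p]mpolyE [in RHS](mpolyE p) mulr_suml !linear_sum mulr_suml.
apply: eq_bigr => m _; rewrite -scalerAl !linearZ /= -scalerAl; congr (_ *: _).
have hm := homog_atX m; have [E|ne] := eqVneq (mdeg m : int) (k - a).
  by rewrite -E (hcomp_id hm) hcomp_id // -[k](subrK a) -E; exact: homog_atM.
rewrite (hcomp_ne hm) // mul0r (hcomp_ne (homog_atM hm hq)) //.
by apply: contraNneq ne => <-; rewrite addrK.
Qed.

Lemma homog_at_divr k a p q : q != 0 -> homog_at a q -> homog_at k (p * q) ->
  homog_at (k - a) p.
Proof.
move=> q0 hq /hcomp_id; rewrite (hcompM _ _ hq) => /(mulIf q0) <-; exact: hcomp_homog.
Qed.

Lemma homog_at_mderiv a i p : homog_at a p -> homog_at (a - 1) p^`M(i).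
Proof.
move=> /homog_atP hp; apply/homog_atP => m; rewrite mcoeff_deriv => pm.
have /hp <- : p@_(m + U_(i)) != 0 by apply: contraNneq pm => ->; rewrite mul0rn.
by rewrite mdegD mdeg1 PoszD addrK.
Qed.

Lemma euler_homog d p : p \is d.-homog -> \sum_i 'X_i * p^`M(i) = d%:R * p.
Proof.
move=> hp; have E (m : 'X_{1..3}) : \sum_i 'X_i * ('X_[m] : S)^`M(i) = (mdeg m)%:R *: 'X_[m].
  under eq_bigr => i _.
    rewrite mderivX -scalerAr.
    have -> : (m i)%:R *: ('X_i * 'X_[m - U_(i)]) = (m i)%:R *: ('X_[m] : S).
      have [->|mi] := posnP (m i); first by rewrite !scale0r.
      by rewrite -mpolyXD addmC submK //; apply/mnm_lepP => j; rewrite mnm1E; case: eqP => [<-|].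
    over.
  by rewrite -scaler_suml -natr_sum mdegE.
rewrite [p in RHS]mpolyE mulr_sumr.
have dpE i : 'X_i * p^`M(i) = \sum_(m <- msupp p) 'X_i * (p@_m *: 'X_[m])^`M(i).
  by rewrite {1}[p]mpolyE (linear_sum (mderiv i)) mulr_sumr.
under eq_bigr => i _ do rewrite dpE.
rewrite exchange_big /= !big_seq; apply: eq_bigr => m /(dhomog_mf hp) <-.
under eq_bigr => i _ do rewrite linearZ /= -scalerAr.
by rewrite -scaler_sumr E -scalerAr mulr_natl scaler_nat.
Qed.

Lemma irrelevantP p : reflect (p@_0%MM = 0) (p \in @irrelevant_ideal K).
Proof.
apply: (iffP (asboolP _)) => [[a ->]|p0].
  rewrite raddf_sum big1 // => i _; have mulM (x y : S) : (x * y)@_0%MM = x@_0%MM * y@_0%MM.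
    exact: (rmorphM (@mcoeff 3 K 0%MM)).
  by rewrite /= mulM mcoeffX mnm1_eq0 mulr0.
have mon (m : 'X_{1..3}) : m != 0%MM -> exists a : 'I_3 -> S, 'X_[m] = \sum_i a i * 'X_i.
  rewrite -mdeg_eq0 mdegE sum_nat_eq0 negb_forall => /existsP[j /= mj].
  exists (fun i => if i == j then 'X_[m - U_(j)] else 0).
  rewrite (bigD1 j) //= eqxx big1 ?addr0 => [|i /negPf->]; last by rewrite mul0r.
  rewrite -mpolyXD submK //; apply/mnm_lepP => i; rewrite mnm1E; case: eqP => [<-|//].
  by rewrite lt0n.
have /choice[a aE] : forall m : 'X_{1..3}, exists a : 'I_3 -> S,
    p@_m *: 'X_[m] = \sum_i a i * 'X_i.
  move=> m; have [->|/mon[a ->]] := eqVneq m 0%MM.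
    by exists (fun=> 0); rewrite p0 scale0r big1 // => i _; rewrite mul0r.
  exists (fun i => p@_m *: a i); rewrite scaler_sumr; apply: eq_bigr => i _.
  by rewrite scalerAl.
exists (fun i => \sum_(m <- msupp p) a m i); rewrite [LHS]mpolyE.
under eq_bigr => m _ do rewrite aE.
by rewrite exchange_big; apply: eq_bigr => i _; rewrite mulr_suml.
Qed.

Lemma unit_mpolyC p : p != 0 -> (forall m, m != 0%MM -> p@_m = 0) -> p \is a GRing.unit.
Proof.
move=> p0 pm; have pE : p = (p@_0%MM)%:MP.
  apply/mpolyP => m; rewrite mcoeffC; have [->|m0] := eqVneq m 0%MM.
    by rewrite mulr1.
  by rewrite pm // mulr0.
have c0 : p@_0%MM != 0 by apply: contraNneq p0 => c0; rewrite pE c0.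
by apply: (@rdvd_unit _ _ 1); rewrite ?unitr1 //; exists (p@_0%MM)^-1%:MP;
  rewrite {2}pE -mpolyCM mulVf.
Qed.

Lemma rdvd_mderiv p i : p != 0 -> rdvd p p^`M(i) -> p^`M(i) = 0.
Proof.
move=> p0 [q qE]; apply/eqP; apply: contraTT isT => dp0.
have q0 : q != 0 by apply: contraNneq dp0 => q0; rewrite qE q0 mul0r.
have lt : (msize p^`M(i) < msize p)%N.
  rewrite -(mlead_deg dp0); set m := mlead _.
  have : m \in msupp p^`M(i) by rewrite mlead_supp.
  rewrite mcoeff_msupp mcoeff_deriv => dpm.
  have /msize_mdeg_lt : (m + U_(i))%MM \in msupp p.
    by rewrite mcoeff_msupp; apply: contraNneq dpm => ->; rewrite mul0rn.
  by rewrite mdegD mdeg1 addn1.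
by move: lt; rewrite qE msizeM // (mpolySpred _ q0) addSn /= ltnNge leq_addl.
Qed.

Hypothesis charK : [pchar K] =i pred0.

Lemma mderiv_eq0_unit p : p != 0 -> (forall i, p^`M(i) = 0) -> p \is a GRing.unit.
Proof.
move=> p0 dp; apply: unit_mpolyC => // m.
rewrite -mdeg_eq0 mdegE sum_nat_eq0 negb_forall => /existsP[j /= mj].
have := congr1 (mcoeff (m - U_(j))%MM) (dp j); rewrite mcoeff_deriv mcoeff0.
rewrite submK; last first.
  by apply/mnm_lepP => i; rewrite mnm1E; case: eqP => [<-|//]; rewrite lt0n.
by rewrite -mulr_natr => /eqP; rewrite mulf_eq0 ((pcharf0P K).1 charK) /= orbF => /eqP.
Qed.

(** Euler's formula gives f = f' g, with f' and g coprime since f is reduced. As the partials of f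
    are divisible by g, so is f' times each partial of g, hence each partial of g; by degree these
    vanish and g is constant. *)
Lemma gradient_coprime d (f : S) : (0 < d)%N -> reduced_curve d f ->
  forall g, (forall i, rdvd g f^`M(i)) -> g \is a GRing.unit.
Proof.
move=> d0 [fd f0 fred] g gf; have dK : d%:R != 0 :> K by rewrite ((pcharf0P K).1 charK) -lt0n.
have [f' f'E] : rdvd g f.
  have : rdvd g (d%:R * f).
    rewrite -(euler_homog fd) sum3E; do !apply: rdvdD; exact: (rdvd_mull _ (gf _)).
  move=> [h hE]; exists (d%:R^-1 *: h); rewrite -scalerAl -hE mulr_natl -scaler_nat.
  by rewrite scalerA mulVf // scale1r.
have g0 : g != 0 by apply: contraNneq f0 => g0; rewrite f'E g0 mulr0.
apply: mderiv_eq0_unit => // i; apply: rdvd_mderiv => //.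
apply: (coprime_cancel2 (@gcd_mpoly K 3) (b := f')) => [h [u uE] [v vE]|].
  by apply: (fred h (u * v)); rewrite f'E uE vE; ring.
have -> : f' * g^`M(i) = f^`M(i) - f'^`M(i) * g by rewrite f'E mderivM; ring.
apply: rdvdB; [exact: gf|exact: (rdvd_mull _ (rdvd_refl g))].
Qed.

End GradedRing.

(** * Binary forms *)

Section LinearAlgebra.
Variable K : fieldType.

Lemma inj_row_free m n (L : {linear 'rV[K]_n -> 'rV[K]_m}) :
  (forall c, L c = 0 -> c = 0) -> row_free (lin1_mx L).
Proof.
move=> Linj; rewrite -kermx_eq0; apply/eqP/row_matrixP => i; rewrite row0.
by apply: Linj; rewrite -mul_rV_lin1 -row_mul mulmx_ker row0.
Qed.

Lemma inj_surj_row n (L : {linear 'rV[K]_n -> 'rV[K]_n}) :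
  (forall c, L c = 0 -> c = 0) -> forall w, exists c, L c = w.
Proof.
move=> /inj_row_free; rewrite row_free_unit => uL w.
by exists (w *m invmx (lin1_mx L)); rewrite -mul_rV_lin1 mulmxKV.
Qed.

Local Notation S := {mpoly K[3]}.
Local Open Scope classical_set_scope.

(** [M] is only an S-module, so K-linearity of [L] is stated through constants and [P] moves [L] to
    coordinates, where matrix ranks apply. The inequality covers degrees where [G] need not fill the
    kernel. *)
Lemma has_dim_rank_nullity (M : lmodType S) (A : set M) r m n (L : 'rV[K]_m -> M)
    (G : {linear 'rV[K]_n -> 'rV[K]_m}) :
  has_dim A r -> (forall a u v, L (a *: u + v) = a%:MP *: L u + L v) ->
  (forall x, A x <-> exists c, L c = x) ->
  (forall c, G c = 0 -> c = 0) -> (forall c, L (G c) = 0) ->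
  (r + n <= m)%N /\ ((forall c, L c = 0 -> exists w, G w = c) -> (r + n = m)%N).
Proof.
move=> [b [Ab Aspan]] Llin AL Ginj LG.
have L0 : L 0 = 0.
  by have := Llin (-1) 0 0; rewrite scaler0 addr0 mpolyCN mpolyC1 scaleN1r addNr.
pose ev (c : 'rV[K]_r) := \sum_i (c 0 i)%:MP *: b i.
have evlin a c c' : ev (a *: c + c') = a%:MP *: ev c + ev c'.
  rewrite /ev scaler_sumr -big_split; apply: eq_bigr => i _ /=.
  by rewrite !mxE mpolyCD mpolyCM scalerDl scalerA.
have /choice[P PE] : forall c, exists w, L c = ev w.
  by move=> c; have /Aspan[w [wE _]] := (AL (L c)).2 (ex_intro _ c erefl); exists w.
have ev_inj w w' c : L c = ev w -> L c = ev w' -> w = w'.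
  move=> E E'; have /Aspan[w0 [_ w0u]] := (AL (L c)).2 (ex_intro _ c erefl).
  by rewrite -(w0u w E) -(w0u w' E').
have Plin : linear P.
  by move=> a u v; apply: (ev_inj _ _ (a *: u + v)); [exact: PE|rewrite evlin -!PE Llin].
pose HP := GRing.isLinear.Build K _ _ _ P Plin.
pose P' : {linear 'rV[K]_m -> 'rV[K]_r} := HB.pack P HP.
have P0 c : P c = 0 <-> L c = 0.
  have ev0 : ev 0 = 0 by rewrite /ev big1 // => i _; rewrite mxE mpolyC0 scale0r.
  split=> [Pc|Lc]; first by rewrite PE Pc ev0.
  by apply: (ev_inj _ _ c); [exact: PE|rewrite ev0].
have Psurj w : exists c, P c = w.
  have /choice[cb cbE] : forall i, exists c, L c = b i by move=> i; apply/AL.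
  have LE s : L (\sum_(i <- s) w 0 i *: cb i) = \sum_(i <- s) (w 0 i)%:MP *: b i.
    elim: s => [|i s IH]; first by rewrite !big_nil L0.
    by rewrite !big_cons Llin IH cbE.
  exists (\sum_i w 0 i *: cb i); apply: (ev_inj _ _ (\sum_i w 0 i *: cb i)); first exact: PE.
  exact: LE.
have rkP : \rank (lin1_mx P') = r.
  apply/eqP; rewrite -[_ == r]/(row_full _) -sub1mx; apply/row_subP => i.
  have [c cE] := Psurj (row i 1%:M); rewrite -cE -[P c]/(P' c) -mul_rV_lin1.
  exact: submxMl.
have rkG : \rank (lin1_mx G) = n by apply/eqP; exact: inj_row_free.
have rm : (r <= m)%N by rewrite -rkP rank_leq_row.
have subGP : (lin1_mx G <= kermx (lin1_mx P'))%MS.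
  apply/row_subP => i; apply/sub_kermxP; rewrite mul_rV_lin1 rowE mul_rV_lin1.
  by apply/P0.
have := mxrankS subGP; rewrite mxrank_ker rkP rkG => nm; split; first lia.
move=> LG'; suff : (kermx (lin1_mx P') <= lin1_mx G)%MS.
  by move/mxrankS; rewrite mxrank_ker rkP rkG; lia.
apply/row_subP => i; have /sub_kermxP := row_sub i (kermx (lin1_mx P')).
rewrite mul_rV_lin1 => /P0/LG'[w <-]; rewrite -mul_rV_lin1; exact: submxMl.
Qed.

End LinearAlgebra.

Section BinaryForms.
Variables (K : fieldType) (e : 'I_3).
Local Notation S := {mpoly K[3]}.
Local Notation eu := (lift e (ord0 : 'I_2)).
Local Notation ev := (lift e (ord_max : 'I_2)).

(** [n] counts the monomials, so their degree is [n.-1]. *)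
Definition bmon n i : 'X_{1..3} := (U_(eu) *+ i + U_(ev) *+ (n.-1 - i))%MM.

Lemma bmon_eu n i : bmon n i eu = i.
Proof.
rewrite mnmDE !mulmnE !mnm1E eqxx mul1n (inj_eq lift_inj) /= mul0n addn0 //.
Qed.

Lemma mdeg_bmon n i : (i < n)%N -> mdeg (bmon n i) = n.-1.
Proof. by move=> lin; rewrite mdegD !mdegMn !mdeg1 !mul1n; lia. Qed.

Definition bform n (c : 'rV[K]_n) : S := \sum_(i < n) c 0 i *: 'X_[bmon n i].
Definition bcoord n (p : S) : 'rV[K]_n := \row_(i < n) p@_(bmon n i).

Lemma bform_is_linear n : linear (@bform n).
Proof.
move=> a u v; rewrite /bform scaler_sumr -big_split; apply: eq_bigr => i _ /=.
by rewrite !mxE scalerDl scalerA.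
Qed.
HB.instance Definition _ n := GRing.isLinear.Build K _ _ _ (@bform n) (@bform_is_linear n).

Lemma bcoord_is_linear n : linear (@bcoord n).
Proof. by move=> a p q; apply/rowP => i; rewrite !mxE mcoeffD mcoeffZ. Qed.
HB.instance Definition _ n := GRing.isLinear.Build K _ _ _ (@bcoord n) (@bcoord_is_linear n).

Lemma bformK n : cancel (@bform n) (@bcoord n).
Proof.
move=> c; apply/rowP => i; rewrite mxE raddf_sum (bigD1 i) //= big1 ?addr0.
  by rewrite mcoeffZ mcoeffX eqxx mulr1.
move=> j ji; rewrite mcoeffZ mcoeffX; case: eqP => [E|]; last by rewrite mulr0.
case/negP: ji; apply/eqP; apply: val_inj.
by have := congr1 (fun m : 'X_{1..3} => m eu) E; rewrite !bmon_eu.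
Qed.

(* The number of monomials of degree k in two variables, also for negative k. *)
Definition bnum (k : int) : nat := if k is Posz n then n.+1 else 0%N.

Lemma homog_bform k (c : 'rV_(bnum k)) : homog_at k (bform c).
Proof.
case: k c => n c; last by rewrite /bform big_ord0; exact: homog_at0.
apply: homog_at_sum => i _; apply: homog_atZ.
by have := homog_atX K (bmon n.+1 i); rewrite mdeg_bmon.
Qed.

Definition isform (k : int) (p : S) := exists c : 'rV_(bnum k), p = bform c.

Lemma isform0 k : isform k 0.
Proof. by exists 0; rewrite raddf0. Qed.

Lemma isformD k p q : isform k p -> isform k q -> isform k (p + q).
Proof. by move=> [c ->] [c' ->]; exists (c + c'); rewrite raddfD. Qed.

Lemma isformZ k a p : isform k p -> isform k (a *: p).
Proof. by move=> [c ->]; exists (a *: c); rewrite linearZ. Qed.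

Lemma isform_sum k I (s : seq I) (P : pred I) (F : I -> S) :
  (forall i, P i -> isform k (F i)) -> isform k (\sum_(i <- s | P i) F i).
Proof. by move=> hF; elim/big_ind: _ => [||//]; [exact: isform0|exact: isformD]. Qed.

Lemma isformX (a b : nat) : isform (a + b)%N 'X_[U_(eu) *+ a + U_(ev) *+ b].
Proof.
have lt : (a < (a + b).+1)%N by rewrite ltnS leq_addr.
exists (delta_mx 0 (Ordinal lt)); rewrite /bform (bigD1 (Ordinal lt)) //= big1 ?addr0.
  by rewrite mxE !eqxx scale1r /bmon /= addKn.
by move=> i /negPf ni; rewrite mxE ni andbF scale0r.
Qed.

Lemma isform_linM (k : nat) (a b : K) p : isform k p ->
  isform k.+1 ((a *: 'X_eu + b *: 'X_ev) * p).
Proof.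
move=> [c ->]; rewrite /bform mulr_sumr; apply: isform_sum => i _ /=.
rewrite -scalerAr mulrDl -!scalerAl -!mpolyXD; apply/isformZ/isformD; apply: isformZ.
  have := isformX i.+1 (k - i); rewrite mulmS -addmA.
  by rewrite addSn subnKC // -ltnS.
have := isformX i (k - i).+1; rewrite mulmS addmA [X in 'X_[X + _]]addmC -addmA.
by rewrite addnS subnKC // -ltnS.
Qed.

Section Elimination.
Variable l : S.
Hypothesis l_lin : homog_at 1 l.
Hypothesis le : l@_U_(e) != 0.

Lemma linear_formE : l = \sum_i l@_U_(i) *: 'X_i.
Proof.
apply/mpolyP => m; rewrite raddf_sum /=.
under eq_bigr => i _ do rewrite mcoeffZ mcoeffX.
have [/eqP|m1] := eqVneq (mdeg m) 1%N.
  rewrite mdeg_eq1 => /existsP[i /eqP->]; rewrite (bigD1 i) //= eqxx mulr1 big1 ?addr0 //.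
  by move=> j ji; rewrite eq_mnm1 (negPf ji) mulr0.
have -> : l@_m = 0.
  by apply/eqP/negPn/negP => /(homog_atP _ _ l_lin) [] /eqP; rewrite (negPf m1).
rewrite big1 // => i _; case: eqP => [E|]; last by rewrite mulr0.
by case/eqP: m1; rewrite -E mdeg1.
Qed.

(** Solves [l = 0] for the variable [e]; the image of ['X_e] involves only the other two
    variables. *)
Definition elim_var (i : 'I_3) : S := if i == e then 'X_e - (l@_U_(e))^-1 *: l else 'X_i.

Definition elim : S -> S := comp_mpoly [tuple elim_var i | i < 3].

HB.instance Definition _ := GRing.RMorphism.copy elim (comp_mpoly [tuple elim_var i | i < 3]).

Lemma elimZ a p : elim (a *: p) = a *: elim p.
Proof. exact: comp_mpolyZ. Qed.

Lemma elimX i : elim 'X_i = elim_var i.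
Proof. by rewrite /elim comp_mpolyXU -tnth_nth tnth_mktuple. Qed.

Lemma elim_l : elim l = 0.
Proof.
rewrite {1}linear_formE raddf_sum (bigD1 e) //=.
have E i : i != e -> elim (l@_U_(i) *: 'X_i) = l@_U_(i) *: 'X_i.
  by move=> /negPf ie; rewrite elimZ elimX /elim_var ie.
rewrite (eq_bigr _ E) elimZ elimX /elim_var eqxx scalerBr scalerA mulfV // scale1r.
by rewrite {2}linear_formE (bigD1 e) //=; rewrite addrAC subrr.
Qed.

Lemma elimE p : exists s, p = elim p + s * l.
Proof.
have EM q q' : (exists s, q = elim q + s * l) -> (exists s, q' = elim q' + s * l) ->
    exists s, q * q' = elim (q * q') + s * l.
  move=> [s sE] [t tE]; exists (s * q' + elim q * t); rewrite rmorphM {1}sE {1 3}tE; ring.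
have EX i : exists s, 'X_i = elim 'X_i + s * l.
  rewrite elimX /elim_var; case: eqP => [->|_]; last by exists 0; rewrite mul0r addr0.
  by exists (l@_U_(e))^-1%:MP; rewrite mul_mpolyC subrK.
have E1 : exists s, (1 : S) = elim 1 + s * l by exists 0; rewrite rmorph1 mul0r addr0.
have Emon m : exists s, ('X_[m] : S) = elim 'X_[m] + s * l.
  rewrite mpolyXE_id; elim/big_ind: _ => // i _.
  by elim: (m i) => [|k IH]; rewrite ?expr0 // exprS; exact: EM.
rewrite [p]mpolyE; elim/big_ind: _ => [|q q' [s sE] [t tE]|m _].
- by exists 0; rewrite rmorph0 mul0r addr0.
- by exists (s + t); rewrite rmorphD {1}sE {1}tE; ring.
- by have [s sE] := Emon m; exists (p@_m *: s); rewrite elimZ {1}sE scalerDr scalerAl.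
Qed.

Lemma elim_var_lin i : exists a b : K, elim_var i = a *: 'X_eu + b *: 'X_ev.
Proof.
have sumE (F : 'I_3 -> S) : \sum_i F i = F e + (F eu + F ev).
  rewrite (bigD1_ord e) //= !big_ord_recl big_ord0 addr0.
  by congr (_ + (_ + F (lift e _))); apply: val_inj.
rewrite /elim_var; case: eqP => [_|/eqP ie].
  exists (- (l@_U_(e))^-1 * l@_U_(eu)), (- (l@_U_(e))^-1 * l@_U_(ev)).
  rewrite {2}linear_formE sumE !scalerDr !scalerA mulVf // scale1r.
  by rewrite !mulNr !scaleNr opprD addrA subrr add0r opprD.
case: (unliftP e i) => [j ->|E]; last by rewrite E eqxx in ie.
case: (unliftP ord0 j) => [k ->|->].
  exists 0, 1; rewrite scale0r add0r scale1r; congr 'X_(lift e _).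
  by apply: val_inj; rewrite /= (ord1 k).
by exists 1, 0; rewrite scale0r addr0 scale1r.
Qed.

Lemma isform_elim k p : homog_at k p -> isform k (elim p).
Proof.
move=> hp; rewrite [p]mpolyE raddf_sum big_seq; apply: isform_sum => m /=.
rewrite mcoeff_msupp => /(homog_atP _ _ hp) <-; rewrite elimZ; apply: isformZ.
have EX i n (j : nat) q : isform j q -> isform (n + j)%N (elim ('X_i ^+ n) * q).
  move=> hq; elim: n => [|n IH]; first by rewrite rmorph1 mul1r.
  rewrite exprS rmorphM /= -mulrA elimX; have [a [b ->]] := elim_var_lin i.
  exact: isform_linM.
have E1 : isform 0%N 1.
  by have := isformX 0 0; rewrite !mulm0n addm0 mpolyX0.
rewrite mpolyXE_id rmorph_prod mdegE /=.
elim/big_rec2: _ => [|i q j _ IH]; first exact: E1.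
exact: EX.
Qed.

Lemma homog_elim k p : homog_at k p -> homog_at k (elim p).
Proof. by move=> /isform_elim[c ->]; exact: homog_bform. Qed.

Lemma elim_bform n (c : 'rV_n) : elim (bform c) = bform c.
Proof.
rewrite /bform raddf_sum; apply: eq_bigr => i _ /=.
rewrite elimZ mpolyXD -!mpolyXn rmorphM !rmorphXn /= !elimX /elim_var.
by rewrite ![lift e _ == e]eq_sym !(negPf (neq_lift _ _)).
Qed.

Lemma bcoordK k p : homog_at k p -> elim p = p -> bform (bcoord (bnum k) p) = p.
Proof. by move=> /isform_elim[c cE] pE; rewrite -pE cE bformK. Qed.

End Elimination.
End BinaryForms.

(** * Plus-one generated curves *)

Section PlusOneGenerated.
Variable K : fieldType.
Local Notation S := {mpoly K[3]}.
Implicit Types (p q : S).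

Lemma mcoeff_hcomp k p m : (hcomp k p)@_m = if (mdeg m)%:Z == k then p@_m else 0.
Proof.
have E m' : (hcomp k ('X_[m'] : S))@_m = if (mdeg m)%:Z == k then ('X_[m'] : S)@_m else 0.
  have hm := homog_atX K m'; have [mk|mk] := eqVneq (mdeg m' : int) k.
    rewrite -mk hcomp_id // mcoeffX; case: (m' =P m) => [->|_]; rewrite ?eqxx ?if_same //.
  rewrite (hcomp_ne hm) // mcoeff0 mcoeffX; case: (m' =P m) => [<-|_]; last by rewrite if_same.
  by rewrite (negPf mk).
rewrite {1}[p]mpolyE [in RHS](mpolyE p) (linear_sum (hcomp k)) !(raddf_sum (mcoeff m)) /=.
case: ifP => mk; last first.
  by apply: big1 => m' _; rewrite linearZ /= mcoeffZ E mk mulr0.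
by apply: eq_bigr => m' _; rewrite linearZ /= !mcoeffZ E mk.
Qed.

Lemma hcomp0E p : hcomp 0 p = (p@_0%MM)%:MP.
Proof.
apply/mpolyP => m; rewrite mcoeff_hcomp mcoeffC eqz_nat mdeg_eq0.
by have [->|_] := eqVneq m 0%MM; rewrite ?mulr1 ?mulr0.
Qed.

Definition gradient (f : S) : 'I_3 -> S := fun i => f^`M(i).

Lemma jacobianP f p : p \in jacobian_ideal f <-> exists B, p = dot B (gradient f).
Proof. by split=> [/asboolP|h] //; apply/asboolP. Qed.

(** Graded Nakayama: in degree [ds i] the coefficient of [r i] is the constant term of [a i]; if it
    were nonzero, [r i] could be dropped from the generators. *)
Lemma minimal_relation f n (ds : 'I_n -> int) (r : 'I_n -> 'rV[S]_3) :
  (forall i, AR f (r i) /\ forall j, homog_at (ds i) (r i 0 j)) ->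
  (forall v, AR f v -> exists a : 'I_n -> S, v = \sum_i a i *: r i) ->
  (forall B : {set 'I_n},
    (forall v, AR f v -> exists a : 'I_n -> S, v = \sum_(i in B) a i *: r i) ->
    B = finset.setT) ->
  forall a : 'I_n -> S, \sum_i a i *: r i = 0 -> forall i, (a i)@_0%MM = 0.
Proof.
move=> rh rgen rmin a ra0 i; apply/eqP/negPn/negP => ai0.
have relE s : \sum_j hcomp (ds i - ds j) (a j) * r j 0 s = 0.
  transitivity (hcomp (ds i) ((\sum_j a j *: r j) 0 s)); last by rewrite ra0 mxE raddf0.
  rewrite summxE (raddf_sum (hcomp (ds i))); apply: eq_bigr => j _ /=.
  by have [_ rj] := rh j; rewrite mxE (hcompM _ _ (rj s)).
pose b j := - ((a i)@_0%MM)^-1 *: hcomp (ds i - ds j) (a j).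
have riE : r i = \sum_(j in [set~ i]) b j *: r j.
  apply/rowP => s; rewrite summxE; have := relE s.
  rewrite (bigD1 i) //= subrr hcomp0E mul_mpolyC => /eqP; rewrite addr_eq0 => /eqP E.
  apply: (scalerI ai0); rewrite E scaler_sumr -sumrN; apply: eq_big => j; first by rewrite !inE.
  by move=> _; rewrite mxE /b -scalerAl scalerA mulrN mulfV // scaleN1r.
have := rmin [set~ i]; suff h : forall v, AR f v -> exists a, v = \sum_(j in [set~ i]) a j *: r j.
  by move=> /(_ h)/setP/(_ i); rewrite !inE eqxx.
move=> v /rgen[c ->]; exists (fun j => c j + c i * b j).
rewrite (bigD1 i) //= riE scaler_sumr addrC.
rewrite [X in X + _](eq_bigl (fun j => j \in [set~ i])); last by move=> j; rewrite !inE.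
by rewrite -big_split; apply: eq_bigr => j _ /=; rewrite scalerDl scalerA.
Qed.

Hypothesis charK : [pchar K] =i pred0.
Variables (d d1 d2 d3 : nat) (f : S).
Hypothesis d_gt0 : (0 < d)%N.
Hypothesis f_reduced : reduced_curve d f.
Hypothesis f_pog : plus_one_generated d f d1 d2 d3.

Lemma pog_generators : exists r1 r2 r3 : 'I_3 -> S,
  [/\ [/\ dot r1 (gradient f) = 0, dot r2 (gradient f) = 0 & dot r3 (gradient f) = 0],
      [/\ forall s, homog_at d1 (r1 s), forall s, homog_at d2 (r2 s) &
          forall s, homog_at d3 (r3 s)],
      forall v, dot v (gradient f) = 0 ->
        exists a1 a2 a3, forall s, v s = a1 * r1 s + a2 * r2 s + a3 * r3 s &
      forall a1 a2 a3, relation r1 r2 r3 a1 a2 a3 ->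
        [/\ a1@_0%MM = 0, a2@_0%MM = 0 & a3@_0%MM = 0]].
Proof.
have [[_ [r [rh rgen rmin]]] _] := f_pog.
pose rr : 'I_3 -> 'rV[S]_3 := r.
exists (rr o0 0), (rr o1 0), (rr o2 0).
have ARE i : dot (rr i 0) (gradient f) = 0 by have [] := rh i.
split; first by split.
- by split=> s; [have [_] := rh o0|have [_] := rh o1|have [_] := rh o2]; apply.
- move=> v vg; have [|a aE] := rgen (\row_i v i).
    by apply: etrans vg; apply: eq_bigr => i _; rewrite mxE.
  exists (a o0), (a o1), (a o2) => s.
  have := congr1 (fun v : 'rV_3 => v 0 s) aE; rewrite mxE summxE => ->.
  by rewrite (sum3E (fun i => (a i *: rr i) 0 s)) !mxE addrA.
move=> a1 a2 a3 rel; pose a (i : 'I_3) : S := [:: a1; a2; a3]`_i.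
have := @minimal_relation f 3 (fun i => (nth 0%N [:: d1; d2; d3] i)%:Z) rr rh rgen rmin a.
have -> : \sum_i a i *: rr i = 0.
  by apply/rowP => s; rewrite sum3E !mxE addrA; exact: rel.
by move=> /(_ erefl) h; split; [have := h o0|have := h o1|have := h o2].
Qed.

Lemma gradient_homog s : homog_at (d%:Z - 1) (gradient f s).
Proof. by have [fd _ _] := f_reduced; exact: homog_at_mderiv. Qed.

Lemma gradient_unit g : (forall s, rdvd g (gradient f s)) -> g \is a GRing.unit.
Proof. exact: (gradient_coprime charK d_gt0 f_reduced). Qed.

Lemma gradient_neq0 : exists s, gradient f s != 0.
Proof.
apply: contrapT => h; have : (0 : S) \is a GRing.unit.
  apply: gradient_unit => s; have [->|gs] := eqVneq (gradient f s) 0; first exact: rdvd0.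
  by case: h; exists s.
by rewrite unitr0.
Qed.

(** Induction on the exponent: if m^(N+1) p lies in J_f, then m^N (c p) does for every c in m.
    Saturation thus needs to be tested against c1, c2, c3 only. *)
Lemma sat_of_step (P : S -> Prop) (c1 c2 c3 : S) :
  c1@_0%MM = 0 -> c2@_0%MM = 0 -> c3@_0%MM = 0 ->
  (forall p, p \in jacobian_ideal f -> P p) ->
  (forall p, P (c1 * p) -> P (c2 * p) -> P (c3 * p) -> P p) ->
  forall p, p \in sat_jacobian_ideal f -> P p.
Proof.
move=> c10 c20 c30 PJ Pstep p /asboolP[N]; elim: N p => [|N IH] p hp.
  by apply: PJ; have := hp (fun=> 0); rewrite big_ord0 mul1r; apply=> -[].
have step c : c@_0%MM = 0 -> P (c * p).
  move=> c0; apply: IH => q qI; rewrite mulrCA.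
  pose q' (i : 'I_N.+1) := oapp q c (unlift ord0 i).
  have q'0 : q' ord0 = c by rewrite /q' unlift_none.
  have q'S i : q' (lift ord0 i) = q i by rewrite /q' liftK.
  have <- : \prod_i q' i * p = c * (\prod_i q i * p).
    rewrite big_ord_recl q'0 -mulrA; congr (_ * (_ * _)).
    by apply: eq_bigr => i _; rewrite q'S.
  apply: hp => i; case: (unliftP ord0 i) => [j ->|->]; rewrite ?q'0 ?q'S //.
  exact/irrelevantP.
by apply: Pstep; exact: step.
Qed.

(** Collects what determines N(f); the generators ri do not appear afterwards. *)
Lemma pog_data : exists (c1 c2 c3 p0 : S) (e : 'I_3),
  [/\ homog_at (d3%:Z + 1 - d1%:Z) c1, homog_at (d3%:Z + 1 - d2%:Z) c2, homog_at 1 c3,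
      c3@_U_(e) != 0 & homog_at (2 * d%:Z - d3%:Z - 3) p0] /\
  [/\ c1@_0%MM = 0, c2@_0%MM = 0 & c3@_0%MM = 0] /\
  [/\ forall a1 a2 a3, a1 * c2 = a2 * c1 -> a2 * c3 = a3 * c2 -> a3 * c1 = a1 * c3 ->
        exists t, [/\ a1 = t * c1, a2 = t * c2 & a3 = t * c3],
      forall a1 a2 a3, c1 * a1 + c2 * a2 + c3 * a3 = 0 -> exists b1 b2 b3,
        [/\ a1 = c2 * b3 - c3 * b2, a2 = c3 * b1 - c1 * b3 & a3 = c1 * b2 - c2 * b1],
      forall p q, elim e c3 c1 * elim e c3 p = elim e c3 c2 * elim e c3 q ->
        exists w, elim e c3 p = elim e c3 c2 * elim e c3 w /\
                  elim e c3 q = elim e c3 c1 * elim e c3 w,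
      forall t, t * p0 \in jacobian_ideal f <->
        exists t1 t2 t3, t = t1 * c1 + t2 * c2 + t3 * c3 &
      forall p, p \in sat_jacobian_ideal f -> exists t, p - t * p0 \in jacobian_ideal f].
Proof.
have [r1 [r2 [r3 [[r1g r2g r3g] [r1h r2h r3h] gen min]]]] := pog_generators.
have dE : (d%:Z = d1%:Z + d2%:Z)%R by have [_ <-] := f_pog.
have gcdS := @gcd_mpoly K 3.
have [c1 [c2 [c3 [c1E c2E c3E]]]] :=
  minors_exist gcdS gradient_neq0 gradient_unit r1g r2g r3g.
have rel := minors_relation gradient_neq0 r1g r2g r3g c1E c2E c3E.
have [c10 c20 c30] := min _ _ _ rel.
have c3n0 : c3 != 0.
  exact: (last_minor_neq0 (aug := mcoeff 0%MM) gcdS gradient_neq0 gen r1g min c1E c2E c3E).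
have homog_minor a b (u v : 'I_3 -> S) c : (forall s, homog_at a (u s)) ->
    (forall s, homog_at b (v s)) -> (forall s, cross u v s = c * gradient f s) ->
    homog_at (a + b - (d%:Z - 1)) c.
  move=> ua vb cE; have [s gs] := gradient_neq0.
  apply: (homog_at_divr gs (gradient_homog s)); rewrite -cE.
  by move: s {gs}; apply: ord3P; rewrite /cross /=; apply: homog_atB; exact: homog_atM.
have c1h : homog_at (d3%:Z + 1 - d1%:Z) c1.
  have := homog_minor _ _ _ _ _ r2h r3h c1E; congr (is_true (homog_at _ _)); rewrite dE; ring.
have c2h : homog_at (d3%:Z + 1 - d2%:Z) c2.
  have := homog_minor _ _ _ _ _ r3h r1h c2E; congr (is_true (homog_at _ _)); rewrite dE; ring.
have c3h : homog_at 1 c3.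
  have := homog_minor _ _ _ _ _ r1h r2h c3E; congr (is_true (homog_at _ _)); rewrite dE; ring.
have [e ce] : exists e, c3@_U_(e) != 0.
  apply: contrapT => h; case/eqP: c3n0; rewrite (linear_formE c3h) big1 // => i _.
  have [->|ci] := eqVneq (c3@_U_(i)) 0; first by rewrite scale0r.
  by case: h; exists i.
pose phi : {rmorphism S -> S} := elim e c3.
have phi_c3 : phi c3 = 0 := elim_l c3h ce.
have phiE : forall p, exists s, p = phi p + s * c3 := elimE e c3.
have min3 a1 a2 : ~ relation r1 r2 r3 a1 a2 1.
  by move=> /min[_ _ /eqP]; rewrite mcoeff1 eqxx oner_eq0.
have rel_cross a1 a2 a3 :=
  relation_cross gradient_neq0 c1E c2E c3E (a1 := a1) (a2 := a2) (a3 := a3).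
have K1 := koszul1 rel min3 c3n0 phi_c3 phiE.
have cop := phi_coprime gcdS gen r1g r2g r3g rel rel_cross min3 c3n0 phi_c3 phiE.
have K2 := koszul2 gcdS gen r1g r2g r3g rel rel_cross min3 c3n0 phi_c3 phiE.
have /choice[A AE] : forall s, exists b : S * S * S,
    [/\ r1 s = c2 * b.2 - c3 * b.1.2, r2 s = c3 * b.1.1 - c1 * b.2 &
        r3 s = c1 * b.1.2 - c2 * b.1.1].
  move=> s; have [|b1 [b2 [b3 bE]]] := K2 (r1 s) (r2 s) (r3 s); first by have := rel s.
  by exists (b1, b2, b3).
(* [koszul2] gives no control of degrees; since r and c are homogeneous, r = c x A survives
   projection of each Ai to degree d - 1 - di. *)
pose A1 s := hcomp (d%:Z - 1 - d1%:Z) (A s).1.1.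
pose A2 s := hcomp (d%:Z - 1 - d2%:Z) (A s).1.2.
pose A3 s := hcomp (d%:Z - 1 - d3%:Z) (A s).2.
have hcompB k q q' c c' a a' : homog_at a c -> homog_at a' c' ->
    hcomp k (c * q - c' * q') = c * hcomp (k - a) q - c' * hcomp (k - a') q'.
  move=> ca ca'; rewrite raddfB /= ![_ * q]mulrC ![_ * q']mulrC (hcompM _ _ ca) (hcompM _ _ ca').
  by rewrite ![hcomp _ _ * _]mulrC.
have r1E s : r1 s = c2 * A3 s - c3 * A2 s.
  have [E _ _] := AE s; rewrite -(hcomp_id (r1h s)) {1}E (hcompB _ _ _ _ _ _ _ c2h c3h) /A3 /A2.
  by congr (_ * hcomp _ _ - _ * hcomp _ _); rewrite dE; ring.
have r2E s : r2 s = c3 * A1 s - c1 * A3 s.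
  have [_ E _] := AE s; rewrite -(hcomp_id (r2h s)) {1}E (hcompB _ _ _ _ _ _ _ c3h c1h) /A3 /A1.
  by congr (_ * hcomp _ _ - _ * hcomp _ _); rewrite dE; ring.
have r3E s : r3 s = c1 * A2 s - c2 * A1 s.
  have [_ _ E] := AE s; rewrite -(hcomp_id (r3h s)) {1}E (hcompB _ _ _ _ _ _ _ c1h c2h) /A1 /A2.
  by congr (_ * hcomp _ _ - _ * hcomp _ _); rewrite dE; ring.
have dotB (c c' : S) (r B B' : 'I_3 -> S) : (forall s, r s = c * B s - c' * B' s) ->
    dot r (gradient f) = 0 -> c * dot B (gradient f) = c' * dot B' (gradient f).
  move=> rE; rewrite (dot_comb2 (a1 := c) (a2 := - c') (u1 := B) (u2 := B')) => [|s].
    by rewrite mulNr => /subr0_eq.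
  by rewrite rE mulNr.
(* Dotting r = c x A with the gradient gives 0, so the vector of the Ai . g is parallel to c. *)
have [t [t1 t2 t3]] := K1 (dot A1 (gradient f)) (dot A2 (gradient f)) (dot A3 (gradient f))
  (etrans (mulrC _ _) (etrans (esym (dotB _ _ _ _ _ r3E r3g)) (mulrC _ _)))
  (etrans (mulrC _ _) (etrans (esym (dotB _ _ _ _ _ r1E r1g)) (mulrC _ _)))
  (etrans (mulrC _ _) (etrans (esym (dotB _ _ _ _ _ r2E r2g)) (mulrC _ _))).
(* The degree is (d - 1 - di) + (d - 1) - deg ci, the same for each i. *)
pose p0 := hcomp (2 * d%:Z - d3%:Z - 3) t.
have dot_homog k (B : 'I_3 -> S) : (forall s, homog_at k (B s)) ->
    homog_at (k + (d%:Z - 1)) (dot B (gradient f)).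
  move=> Bk; apply: homog_at_sum => i _; apply: homog_atM => //; exact: gradient_homog.
have p0E k a c B : (forall s, homog_at k (B s)) -> homog_at a c ->
    k + (d%:Z - 1) - a = 2 * d%:Z - d3%:Z - 3 ->
    dot B (gradient f) = t * c -> dot B (gradient f) = p0 * c.
  move=> Bk ca kE E; rewrite -(hcomp_id (dot_homog _ _ Bk)) E (hcompM _ _ ca) /p0 -kE //.
have A1g : dot A1 (gradient f) = p0 * c1.
  apply: (p0E _ _ _ _ _ c1h _ t1) => [s|]; [exact: hcomp_homog|rewrite dE; ring].
have A2g : dot A2 (gradient f) = p0 * c2.
  apply: (p0E _ _ _ _ _ c2h _ t2) => [s|]; [exact: hcomp_homog|rewrite dE; ring].
have A3g : dot A3 (gradient f) = p0 * c3.
  apply: (p0E _ _ _ _ _ c3h _ t3) => [s|]; [exact: hcomp_homog|rewrite dE; ring].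
exists c1, c2, c3, p0, e; split; first by split=> //; exact: hcomp_homog.
split=> //; split=> //.
  move=> u; rewrite jacobianP.
  exact: (ann_generator gen rel rel_cross min3 c3n0 phi_c3 phiE r3E A1g A2g A3g).
move=> p psat.
have [B [b pE]] : exists B b, p = dot B (gradient f) + b * p0.
  move: p psat; apply: (sat_of_step c10 c20 c30) => [q /jacobianP[B ->]|q].
    by exists B, 0; rewrite mul0r addr0.
  exact: (generator_saturated gcdS gen r1g r2g r3g rel rel_cross min3 c3n0 phi_c3 phiE
    r1E r2E r3E A1g A2g A3g).
by exists b; apply/jacobianP; exists B; rewrite pE addrK.
Qed.

End PlusOneGenerated.

(** * The Jacobian module *)

Section CyclicJacobianModule.
Variable K : fieldType.
Local Notation S := {mpoly K[3]}.
Variables (f c1 c2 c3 p0 : S) (e : 'I_3) (a b : nat) (k0 m0 : int).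
Hypothesis gradient_h : forall s, homog_at m0 (gradient f s).
Hypotheses (c1h : homog_at a.+1 c1) (c2h : homog_at b.+1 c2) (c3h : homog_at 1 c3).
Hypothesis (c3e : c3@_U_(e) != 0).
Hypothesis p0h : homog_at k0 p0.
Hypotheses (c10 : c1@_0%MM = 0) (c20 : c2@_0%MM = 0) (c30 : c3@_0%MM = 0).
Local Notation phi := (elim e c3).
Hypothesis c_koszul1 : forall a1 a2 a3, a1 * c2 = a2 * c1 -> a2 * c3 = a3 * c2 ->
  a3 * c1 = a1 * c3 -> exists t, [/\ a1 = t * c1, a2 = t * c2 & a3 = t * c3].
Hypothesis c_koszul2 : forall a1 a2 a3, c1 * a1 + c2 * a2 + c3 * a3 = 0 ->
  exists b1 b2 b3, [/\ a1 = c2 * b3 - c3 * b2, a2 = c3 * b1 - c1 * b3 & a3 = c1 * b2 - c2 * b1].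
Hypothesis c_coprime : forall p q, phi c1 * phi p = phi c2 * phi q ->
  exists w, phi p = phi c2 * phi w /\ phi q = phi c1 * phi w.

Definition in_c t := exists t1 t2 t3, t = t1 * c1 + t2 * c2 + t3 * c3.

Hypothesis p0_ann : forall t, t * p0 \in jacobian_ideal f <-> in_c t.
Hypothesis p0_gen : forall p, p \in sat_jacobian_ideal f ->
  exists t, p - t * p0 \in jacobian_ideal f.

Let phi_c3 : phi c3 = 0 := elim_l c3h c3e.
Let phiE p : exists s, p = phi p + s * c3 := elimE e c3 p.
Let phiK p : phi (phi p) = phi p := phi_idem phi_c3 phiE p.

Lemma elim_mcoeff0 p : (phi p)@_0%MM = p@_0%MM.
Proof.
have [s {2}->] := phiE p; rewrite mcoeffD -/(mcoeff 0%MM _).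
have -> : (s * c3)@_0%MM = s@_0%MM * c3@_0%MM by exact: (rmorphM (mcoeff 0%MM)).
by rewrite c30 mulr0 addr0.
Qed.

(** If [phi c2] were 0, coprimality for the pair (0, 1) would write 1 as a multiple of [phi c1],
    which has no constant term. *)
Lemma elim_c2_neq0 : phi c2 != 0.
Proof.
apply/eqP => c20'; have [|w [_ /(congr1 (mcoeff 0%MM))]] := @c_coprime 0 1.
  by rewrite c20' rmorph0 mulr0 mul0r.
have -> : (phi c1 * phi w)@_0%MM = (phi c1)@_0%MM * (phi w)@_0%MM.
  exact: (rmorphM (mcoeff 0%MM)).
by rewrite !elim_mcoeff0 c10 mul0r mcoeff1 eqxx => /eqP; rewrite oner_eq0.
Qed.

Lemma in_c_elim t : in_c t <-> exists s1 s2, phi t = phi s1 * phi c1 + phi s2 * phi c2.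
Proof.
split=> [[t1 [t2 [t3 ->]]]|[s1 [s2 E]]].
  by exists t1, t2; rewrite !rmorphD !rmorphM /= phi_c3 mulr0 addr0.
have [u uE] := phiE t; have [u1 u1E] := phiE c1; have [u2 u2E] := phiE c2.
exists (phi s1), (phi s2), (u - phi s1 * u1 - phi s2 * u2).
by rewrite uE E {2}u1E {2}u2E; ring.
Qed.

Lemma in_cD s t : in_c s -> in_c t -> in_c (s + t).
Proof.
move=> [s1 [s2 [s3 ->]]] [t1 [t2 [t3 ->]]].
exists (s1 + t1), (s2 + t2), (s3 + t3); ring.
Qed.

Lemma in_cM s t : in_c t -> in_c (s * t).
Proof.
by move=> [t1 [t2 [t3 ->]]]; exists (s * t1), (s * t2), (s * t3); ring.
Qed.

(* The Sylvester map (s, t) |-> s c1 + t c2 on binary forms of degrees b and a is injective by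
   coprimality, hence bijective by dimension. *)
Lemma in_c_high_degree t : homog_at (b + a.+1)%N t -> in_c t.
Proof.
move=> th; apply/in_c_elim; pose n := (b.+1 + a.+1)%N.
pose X (v : 'rV[K]_n) := bform e (lsubmx v) * phi c1 + bform e (rsubmx v) * phi c2.
have Xlin : linear X.
  move=> k u v; rewrite /X !linearP /= !mulrDl -!scalerAl scalerDr; ring.
have XhK v : homog_at (b + a.+1)%N (X v) /\ phi (X v) = X v.
  split; last by rewrite rmorphD !rmorphM /= !phiK !elim_bform.
  apply: homog_atD.
    by rewrite PoszD; apply: homog_atM; [exact: (homog_bform e (k := b))|exact: homog_elim].
  rewrite addnC addSnnS PoszD.
  by apply: homog_atM; [exact: (homog_bform e (k := a))|exact: homog_elim].
have XK v : bform e (bcoord e n (X v)) = X v.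
  by have [Xh Xphi] := XhK v; exact: (bcoordK c3h c3e Xh Xphi).
pose L v := bcoord e n (X v).
have Llin : linear L by move=> k u v; rewrite /L Xlin linearP.
pose HL := GRing.isLinear.Build K _ _ _ L Llin.
pose L' : {linear 'rV[K]_n -> 'rV[K]_n} := HB.pack L HL.
have Linj v : L' v = 0 -> v = 0.
  move=> Lv; have Xv : X v = 0 by rewrite -XK -/(L v) -[L v]/(L' v) Lv raddf0.
  set s := lsubmx v in Xv *; set u := rsubmx v in Xv *.
  have [|w [sw _]] := @c_coprime (bform e s) (- bform e u).
    apply/eqP; rewrite rmorphN /= !elim_bform mulrN -addr_eq0 -Xv /X -/s -/u; apply/eqP; ring.
  rewrite elim_bform mulrC in sw.
  have s0 : bform e s = 0.
    (* A form of degree [b] is here a multiple of a form of degree [b.+1]; the cofactor sits in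
       degree -1, that is [Negz 0], and vanishes. *)
    rewrite -(hcomp_id (homog_bform e (k := b) s)) sw (hcompM _ _ (homog_elim c3h c3e c2h)).
    have -> : (b%:Z - b.+1%:Z = Negz 0) by lia.
    by rewrite mul0r.
  have u0 : bform e u = 0.
    by apply: (mulIf elim_c2_neq0); rewrite mul0r -Xv /X -/s s0 mul0r add0r.
  have sub0 m (x : 'rV[K]_m) : bform e x = 0 -> x = 0.
    by move=> x0; rewrite -(bformK e x) x0 raddf0.
  by rewrite -[v]hsubmxK -/s -/u (sub0 _ _ s0) (sub0 _ _ u0) row_mx0.
have [v vE] := inj_surj_row Linj (bcoord e n (phi t)).
exists (bform e (lsubmx v)), (bform e (rsubmx v)).
rewrite !elim_bform -/(X v) -XK -/(L v) -[L v]/(L' v) vE.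
by rewrite (bcoordK c3h c3e (homog_elim c3h c3e th) (phiK t)).
Qed.

Lemma homog_at_prod n (F : 'I_n -> S) :
  (forall i, homog_at 1 (F i)) -> homog_at n (\prod_i F i).
Proof.
elim: n F => [|n IH] F hF.
  by rewrite big_ord0; have := homog_atX K (0%MM : 'X_{1..3}); rewrite mdeg0 mpolyX0.
rewrite big_ord_recl; have -> : n.+1%:Z = 1 + n%:Z by lia.
by apply: homog_atM => //; exact: IH.
Qed.

(** A product of a + b + 1 elements of m expands into multiples of monomials of that degree, all of
    which annihilate p0 modulo J_f. *)
Lemma p0_sat : p0 \in sat_jacobian_ideal f.
Proof.
apply/asboolP; exists (b + a.+1)%N => q qI; apply/p0_ann.
have /choice[u uE] : forall i, exists v : 'I_3 -> S, q i = \sum_j v j * 'X_j.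
  by move=> i; exact/asboolP/qI.
under eq_bigr => i _ do rewrite uE.
rewrite bigA_distr_bigA /=; elim/big_ind: _ => [||g _].
- by exists 0, 0, 0; rewrite !mul0r !addr0.
- exact: in_cD.
rewrite big_split /=; apply: in_cM; apply: in_c_high_degree.
by apply: homog_at_prod => i; have := homog_atX K U_(g i)%MM; rewrite mdeg1.
Qed.

Definition jgen : jacobian_module f := lquot_proj (jacobian_in_sat f) (Submod p0_sat).

Lemma scale_jgen t : t *: jgen = lquot_proj (jacobian_in_sat f) (t *: Submod p0_sat).
Proof. by rewrite linearZ. Qed.

Lemma jgen_ann t : t *: jgen = 0 <-> in_c t.
Proof.
rewrite scale_jgen -p0_ann -[X in _ = X](linear0 (lquot_proj (jacobian_in_sat f))).
by rewrite lquot_projP subr0.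
Qed.

Lemma jacobian_compP k x :
  jacobian_comp f k x <-> exists t, homog_at (k - k0) t /\ x = t *: jgen.
Proof.
have smem (y : sat_jacobian_module f) : submod_val y \in sat_jacobian_ideal f by case: y.
split=> [[y yk <-]|[t [th ->]]]; last first.
  exists (t *: Submod p0_sat); last by rewrite scale_jgen.
  by rewrite /= -[k](subrK k0); exact: homog_atM.
have [t /jacobianP[B BE]] := p0_gen (smem y).
exists (hcomp (k - k0) t); split; first exact: hcomp_homog.
rewrite scale_jgen; apply/lquot_projP.
have E : submod_val y - hcomp (k - k0) t * p0 \in jacobian_ideal f.
  apply/jacobianP; exists (fun s => hcomp (k - m0) (B s)).
  rewrite -{1}(hcomp_id yk) -(hcompM _ _ p0h) -raddfB BE (raddf_sum (hcomp k)).
  by apply: eq_bigr => s _; exact: (hcompM _ _ (gradient_h s)).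
exact: E.
Qed.

Lemma jacobian_comp_form k x : jacobian_comp f k x <->
  exists c : 'rV_(bnum (k - k0)), bform e c *: jgen = x.
Proof.
rewrite jacobian_compP; split=> [[t [th ->]]|[c <-]]; last first.
  by exists (bform e c); split=> //; exact: homog_bform.
have [c cE] := isform_elim c3h c3e th; exists c; rewrite -cE.
apply/subr0_eq; rewrite -scalerBl; apply/jgen_ann.
have [s sE] := phiE t; exists 0, 0, (- s); rewrite {2}sE; ring.
Qed.

(** N(f)_k consists of the binary forms of degree j modulo [phi c1] and [phi c2]. Multiples of
    [phi c2] account for the subtracted count; in degrees below that of c1 there is nothing else to
    divide out. *)
Lemma jacobian_hilb_count k : let j := k - k0 in
  (jacobian_hilb f k + bnum (j - b.+1%:Z) <= bnum j)%N /\
  (j < a.+1%:Z -> (jacobian_hilb f k + bnum (j - b.+1%:Z) = bnum j)%N).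
Proof.
move=> j; pose L (c : 'rV[K]_(bnum j)) := bform e c *: jgen.
pose G (w : 'rV[K]_(bnum (j - b.+1%:Z))) := bcoord e (bnum j) (bform e w * phi c2).
have Glin : linear G by move=> k' u v; rewrite /G linearP mulrDl -scalerAl linearP.
pose HG := GRing.isLinear.Build K _ _ _ G Glin.
pose G' : {linear 'rV[K]_(bnum (j - b.+1%:Z)) -> 'rV[K]_(bnum j)} := HB.pack G HG.
have GE w : bform e (G w) = bform e w * phi c2.
  apply: (bcoordK c3h c3e); last by rewrite rmorphM /= phiK elim_bform.
  by have := homog_atM (homog_bform e w) (homog_elim c3h c3e c2h); rewrite subrK.
have Llin k' u v : L (k' *: u + v) = k'%:MP *: L u + L v.
  have E : bform e (k' *: u + v) = k'%:MP * bform e u + bform e v.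
    by rewrite linearP mul_mpolyC.
  by rewrite /L E scalerDl scalerA.
have Ginj w : G' w = 0 -> w = 0.
  move=> Gw; rewrite -(bformK e w).
  have -> : bform e w = 0.
    by apply: (mulIf elim_c2_neq0); rewrite mul0r -GE -[G w]/(G' w) Gw raddf0.
  by rewrite raddf0.
have LG w : L (G' w) = 0.
  rewrite /L -[G' w]/(G w) GE; apply/jgen_ann/in_c_elim; exists 0, (bform e w).
  by rewrite rmorphM /= phiK rmorph0 mul0r add0r.
have [le eq] := has_dim_rank_nullity (svalP (cid (jacobian_comp_dim f k))) Llin
  (jacobian_comp_form k) Ginj LG.
split=> // ja; apply: eq => c /jgen_ann/in_c_elim[s1 [s2 E]].
rewrite elim_bform in E.
exists (bcoord e (bnum (j - b.+1%:Z)) (phi (hcomp (j - b.+1%:Z) (phi s2)))).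
rewrite -[RHS](bformK e) -[LHS](bformK e) -[G' _]/(G _) GE; congr bcoord.
rewrite (bcoordK c3h c3e (homog_elim c3h c3e (hcomp_homog _ _)) (phiK _)).
rewrite -[RHS](@elim_bform K e c3) -(hcomp_id (homog_bform e c)) {1}E raddfD /=.
rewrite (hcompM _ _ (homog_elim c3h c3e c1h)) (hcompM _ _ (homog_elim c3h c3e c2h)).
have -> : hcomp (j - a.+1%:Z) (phi s1) = 0.
  have : j - a.+1%:Z < 0 by rewrite subr_lt0.
  by case: (j - a.+1%:Z).
by rewrite mul0r add0r rmorphM /= phiK.
Qed.

(** The Koszul complex of c, its second module with basis e1^e2, e1^e3, e2^e3. *)
Lemma jacobian_resolution : minimal_free_resolution (jacobian_comp f)
  (nth [::] [:: [:: k0]; [:: k0 + a.+1%:Z; k0 + b.+1%:Z; k0 + 1];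
    [:: k0 + a.+1%:Z + b.+1%:Z; k0 + a.+1%:Z + 1; k0 + b.+1%:Z + 1];
    [:: k0 + a.+1%:Z + b.+1%:Z + 1]]).
Proof.
pose aa := nth [::] [:: [:: k0]; [:: k0 + a.+1%:Z; k0 + b.+1%:Z; k0 + 1];
    [:: k0 + a.+1%:Z + b.+1%:Z; k0 + a.+1%:Z + 1; k0 + b.+1%:Z + 1];
    [:: k0 + a.+1%:Z + b.+1%:Z + 1]].
pose eps0 (v : 'rV[S]_1) : jacobian_module f := v 0 0 *: jgen.
have Elin : linear eps0 by move=> k u v; rewrite /eps0 !mxE scalerDl scalerA.
pose HE := GRing.isLinear.Build S _ _ _ eps0 Elin.
pose eps : {linear 'rV[S]_1 -> jacobian_module f} := HB.pack eps0 HE.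
pose D0 (v : 'rV[S]_3) : 'rV[S]_1 := const_mx (v 0 o0 * c1 + v 0 o1 * c2 + v 0 o2 * c3).
pose D1 (v : 'rV[S]_3) : 'rV[S]_3 := \row_i [:: v 0 o0 * c2 + v 0 o1 * c3;
  v 0 o2 * c3 - v 0 o0 * c1; - (v 0 o1 * c1) - v 0 o2 * c2]`_i.
pose D2 (v : 'rV[S]_1) : 'rV[S]_3 := \row_i [:: v 0 0 * c3; - (v 0 0 * c2); v 0 0 * c1]`_i.
have D0lin : linear D0 by move=> k u v; apply/rowP => i; rewrite !mxE; ring.
have D1lin : linear D1.
  by move=> k u v; apply/rowP; apply: ord3P; rewrite !mxE /=; ring.
have D2lin : linear D2.
  by move=> k u v; apply/rowP; apply: ord3P; rewrite !mxE /=; ring.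
pose HD0 := GRing.isLinear.Build S _ _ _ D0 D0lin.
pose HD1 := GRing.isLinear.Build S _ _ _ D1 D1lin.
pose HD2 := GRing.isLinear.Build S _ _ _ D2 D2lin.
pose D0' : {linear 'rV[S]_3 -> 'rV[S]_1} := HB.pack D0 HD0.
pose D1' : {linear 'rV[S]_3 -> 'rV[S]_3} := HB.pack D1 HD1.
pose D2' : {linear 'rV[S]_1 -> 'rV[S]_3} := HB.pack D2 HD2.
pose diff i : {linear 'rV[S]_(size (aa i.+1)) -> 'rV[S]_(size (aa i))} :=
  match i return {linear 'rV[S]_(size (aa i.+1)) -> 'rV[S]_(size (aa i))} with
  | 0 => D0' | 1 => D1' | 2 => D2' | _ => \0 end.
have c3n0 : c3 != 0 by apply: contraNneq c3e => ->; rewrite mcoeff0.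
have aa0 i : size (aa i.+4) = 0%N by rewrite /aa /= nth_nil.
have in_m c q : c@_0%MM = 0 -> q * c \in @irrelevant_ideal K.
  by move=> c0; apply/irrelevantP; rewrite (rmorphM (mcoeff 0%MM)) /= c0 mulr0.
have hM k x c kx kc : homog_at kx x -> homog_at kc c -> kx + kc = k -> homog_at k (x * c).
  by move=> hx hc <-; exact: homog_atM.
exists eps, diff; split.
- split=> [k v vk|[|[|[|i]]] k v vk].
  + by apply/jacobian_compP; exists (v 0 0); split=> //; exact: (vk ord0).
  + have v0 := vk o0; have v1 := vk o1; have v2 := vk o2; rewrite /= in v0 v1 v2.
    move=> j; rewrite mxE (ord1 j) /=.
    by do !apply: homog_atD; [apply: hM v0 c1h _|apply: hM v1 c2h _|apply: hM v2 c3h _]; ring.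
  + have v0 := vk o0; have v1 := vk o1; have v2 := vk o2; rewrite /= in v0 v1 v2.
    apply: ord3P; rewrite mxE /=.
    * by apply: homog_atD; [apply: hM v0 c2h _|apply: hM v1 c3h _]; ring.
    * by apply: homog_atB; [apply: hM v2 c3h _|apply: hM v0 c1h _]; ring.
    * by apply: homog_atB; first apply: homog_atN; [apply: hM v1 c1h _|apply: hM v2 c2h _]; ring.
  + have v0 := vk ord0; rewrite /= in v0.
    apply: ord3P; rewrite mxE /=; try apply: homog_atN.
    * by apply: hM v0 c3h _; ring.
    * by apply: hM v0 c2h _; ring.
    * by apply: hM v0 c1h _; ring.
  + by move=> j; rewrite mxE homog_at0.
- move=> x; have [t tE] : exists t, x = t *: jgen.
    rewrite -(lquot_reprK x); case: (repr x) => y ysat.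
    have [t tE] := p0_gen ysat; exists t; rewrite scale_jgen; apply/lquot_projP; exact: tE.
  by exists (const_mx t); rewrite /= /eps0 mxE tE.
- move=> v; rewrite -[eps v]/(v 0 0 *: jgen) jgen_ann; split=> [[t1 [t2 [t3 vE]]]|[w <-]].
    exists (\row_i [:: t1; t2; t3]`_i); apply/rowP => i.
    by rewrite (ord1 i) vE -[diff 0%N _]/(D0 _) !mxE.
  by exists (w 0 o0), (w 0 o1), (w 0 o2); rewrite -[diff 0%N _]/(D0 w) mxE.
- move=> [|[|[|i]]] v.
  + rewrite -[diff 0%N v]/(D0 v); split=> [/(congr1 (fun m : 'rV_1 => m 0 0))|[w <-]].
      rewrite !mxE => E0; have [|b1 [b2 [b3 [v0 v1 v2]]]] := @c_koszul2 (v 0 o0) (v 0 o1) (v 0 o2).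
        by rewrite -E0; ring.
      (* [c_koszul1] and [c_koszul2] index a pair by the complementary entry, hence the reversed
         order and the sign. *)
      exists (\row_i [:: b3; - b2; b1]`_i); rewrite -[diff 1%N _]/(D1 _).
      by apply/rowP; apply: ord3P; rewrite !mxE /= ?v0 ?v1 ?v2; ring.
    by rewrite -[diff 1%N _]/(D1 w); apply/rowP => i; rewrite !mxE /=; ring.
  + rewrite -[diff 1%N v]/(D1 v); split=> [D1v|[w <-]].
      have := congr1 (fun m : 'rV_3 => m 0 o0) D1v; have := congr1 (fun m : 'rV_3 => m 0 o1) D1v.
      have := congr1 (fun m : 'rV_3 => m 0 o2) D1v; rewrite !mxE /= => E2 E1 E0.
      have sub (x y z : S) : z = 0 -> x - y = z -> x = y by move=> -> /subr0_eq.
      have [|||t [v0 v1 v2]] := @c_koszul1 (v 0 o2) (- v 0 o1) (v 0 o0).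
      * by apply/esym/(sub _ _ _ E2); ring.
      * by apply/esym/(sub _ _ _ E0); ring.
      * by apply/esym/(sub _ _ _ E1); ring.
      exists (const_mx t); apply/rowP; apply: ord3P; rewrite !mxE /=.
      * by rewrite v2.
      * by rewrite -v1 opprK.
      * by rewrite v0.
    by rewrite -[diff 2%N _]/(D2 w); apply/rowP; apply: ord3P; rewrite !mxE /=; ring.
  + rewrite -[diff 2%N v]/(D2 v); split=> [D2v|[w <-]]; last by rewrite -[D2 _]/(D2' _) raddf0.
    exists 0; rewrite raddf0; apply/rowP => i; rewrite (ord1 i) mxE.
    apply: (mulIf c3n0); rewrite mul0r.
    by have := congr1 (fun m : 'rV_3 => m 0 o0) D2v; rewrite !mxE.
  + split=> _ //; exists 0; rewrite raddf0; apply/rowP => j.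
    by have := ltn_ord j; rewrite {2}aa0.
- move=> [|[|[|i]]] v.
  + move=> j; rewrite -[diff 0%N _]/(D0 v) mxE.
    by do !apply: rpredD; exact: in_m.
  + rewrite -[diff 1%N _]/(D1 v); apply: ord3P; rewrite mxE /=; do ?apply: rpredB;
      do ?apply: rpredD; rewrite ?rpredN; exact: in_m.
  + by rewrite -[diff 2%N _]/(D2 v); apply: ord3P; rewrite mxE /= ?rpredN; exact: in_m.
  + by move=> j; rewrite mxE rpred0.
Qed.

End CyclicJacobianModule.

(** * Numerical bounds and the theorem *)

Lemma ler_half_int (m n : int) : (m%:Q <= n%:Q / 2) = (2 * m <= n).
Proof. by rewrite ler_pdivlMr // mulrC -[2]/(2%:~R) -intrM ler_int. Qed.

Lemma ltr_half_int (m n : int) : (m%:Q < n%:Q / 2) = (2 * m < n).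
Proof. by rewrite ltr_pdivlMr // mulrC -[2]/(2%:~R) -intrM ltr_int. Qed.

(** Bounds n(f)_k by d3 - d2 + 1 in every degree, also where only the inequality of
    [jacobian_hilb_count] holds. *)
Lemma bnum_subr (x : int) (m : nat) : (bnum x <= bnum (x - m%:Z) + m)%N.
Proof.
case: x => n //=; case E: (n%:Z - m%:Z) => [k|k] /=; lia.
Qed.

Theorem corollary3p10 (R : realType) (d d1 d2 d3 : nat) (f : {mpoly R[i][3]}) :
  (3 <= d)%N ->
  reduced_curve d f ->
  plus_one_generated d f d1 d2 d3 ->
  (d2 < d3)%N ->
  let k1 : int := 2 * d%:Z - d1%:Z - 3 in
  let k2 : int := 2 * d%:Z - d2%:Z - 3 in
  let k3 : int := 2 * d%:Z - d3%:Z - 3 in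
  let T : int := 3 * d%:Z - 6 in
  [/\ minimal_free_resolution (jacobian_comp f)
        (nth [::] [:: [:: k3];
                      [:: k1 + 1; k2 + 1; k3 + 1];
                      [:: d%:Z + d3%:Z - 1; k1 + 2; k2 + 2];
                      [:: d%:Z + d3%:Z]]),
      is_sigma f k3,
      (forall k : int, k < k3 -> jacobian_hilb f k = 0%N) /\
        k3%:Q < T%:Q / 2,
      [/\ forall k : int, k3 <= k <= k2 -> (jacobian_hilb f k)%:Z = k - k3 + 1,
          k2 = d%:Z + d1%:Z - 3 &
          k2%:Q <= T%:Q / 2] &
      (forall k : int, k2 <= k -> k%:Q <= T%:Q / 2 ->
        jacobian_hilb f k = (d3 - d2 + 1)%N) /\
        is_nu f (d3 - d2 + 1)%N].
Proof.
move=> d_ge3 f_red f_pog d23 k1 k2 k3 T.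
have charC : [pchar R[i]] =i pred0 by exact: pchar_num.
have d_gt0 : (0 < d)%N by apply: leq_trans d_ge3.
have dE : (d1 + d2 = d)%N by case: f_pog.
have d12 : (d1 <= d2)%N by have [[/= /and3P[]]] := f_pog.
have [c1 [c2 [c3 [p0 [e [[c1h c2h c3h c3e p0h] [[c10 c20 c30] [K1 K2 cop ann gen]]]]]]]] :=
  pog_data charC d_gt0 f_red f_pog.
have aE : d3%:Z + 1 - d1%:Z = (d3 - d1).+1%:Z by lia.
have bE : d3%:Z + 1 - d2%:Z = (d3 - d2).+1%:Z by lia.
rewrite aE in c1h; rewrite bE in c2h.
have count k :=
  jacobian_hilb_count (gradient_homog f_red) c1h c2h c3h c3e p0h c10 c30 cop ann gen k.
have res :=
  jacobian_resolution (gradient_homog f_red) c1h c2h c3h c3e p0h c10 c20 c30 K1 K2 cop ann gen.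
have hilb0 (k : int) : k < k3 -> jacobian_hilb f k = 0%N.
  move=> kk3; have [] := count k; rewrite -/k3.
  have : k - k3 < 0 by rewrite subr_lt0.
  by case: (k - k3) => // n _ /=; rewrite leqn0 addn_eq0 => /andP[/eqP].
have hilb1 (k : int) : k3 <= k <= k2 -> (jacobian_hilb f k)%:Z = k - k3 + 1.
  move=> /andP[k3k kk2]; have [_] := count k; rewrite -/k3.
  have [j jE] : exists j : nat, k - k3 = j%:Z by exists (absz (k - k3)%R); lia.
  (* Up to k2 the degree k - k3 is at most d3 - d2, one less than deg c2. *)
  have -> : bnum (k - k3 - (d3 - d2).+1%:Z) = 0%N.
    have : k - k3 - (d3 - d2).+1%:Z < 0 by lia.
    by case: (k - k3 - (d3 - d2).+1%:Z).
  rewrite jE /= addn0 => ->; lia.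
(* From 2 d1 <= d and 2 k <= T follows k - k3 <= d3 - d1 < deg c1, so the exact count applies. *)
have hilb2 (k : int) : k2 <= k -> 2 * k <= T -> jacobian_hilb f k = (d3 - d2 + 1)%N.
  move=> k2k kT; have [_] := count k; rewrite -/k3.
  have [j jE] : exists j : nat, k - k3 - (d3 - d2)%N%:Z = j%:Z.
    by exists (absz (k - k3 - (d3 - d2)%N%:Z)%R); lia.
  have -> : k - k3 = (j + (d3 - d2))%N%:Z by lia.
  (* At k = k2 the degree is -1 and the count 0, so [j] is right there as well. *)
  have -> : bnum ((j + (d3 - d2))%N%:Z - (d3 - d2).+1%:Z) = j.
    have -> : (j + (d3 - d2))%N%:Z - (d3 - d2).+1%:Z = j%:Z - 1 by lia.
    by case: (j) => [|j'] //; have -> : j'.+1%:Z - 1 = j'%:Z by lia.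
  move=> /(_ _)/= E; have : (jacobian_hilb f k + j = (j + (d3 - d2)).+1)%N by apply: E; lia.
  lia.
have hilb_le (k : int) : (jacobian_hilb f k <= d3 - d2 + 1)%N.
  have [le_k _] := count k; have := leq_trans le_k (bnum_subr _ (d3 - d2).+1).
  by rewrite addnC leq_add2l addn1.
split.
- have -> : k1 + 1 = k3 + (d3 - d1).+1%:Z by lia.
  have -> : k2 + 1 = k3 + (d3 - d2).+1%:Z by lia.
  have -> : k1 + 2 = k3 + (d3 - d1).+1%:Z + 1 by lia.
  have -> : k2 + 2 = k3 + (d3 - d2).+1%:Z + 1 by lia.
  have -> : d%:Z + d3%:Z - 1 = k3 + (d3 - d1).+1%:Z + (d3 - d2).+1%:Z by lia.
  have -> : d%:Z + d3%:Z = k3 + (d3 - d1).+1%:Z + (d3 - d2).+1%:Z + 1 by lia.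
  exact: res.
- split=> [/=|j /= hj]; first by have := hilb1 k3; lia.
  by rewrite leNgt; apply: contraNN hj => /hilb0 ->.
- by split=> //; rewrite ltr_half_int; lia.
- by split=> //; rewrite ?ler_half_int; lia.
split=> [k k2k|]; first by rewrite ler_half_int; exact: hilb2.
split=> [|_ [k _ <-]]; last exact: hilb_le.
by exists k2 => //; apply: hilb2; lia.
Qed.
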